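(* Consider a random walk $(X_n)_{n\ge0}$, $X_0=0$, whose i.i.d. jumps have an arbitrary symmetric and continuous distribution. Let $(\tau_1,\tau_2,\dots,\tau_{m-1},A_n)$, where $m=R_n$, be the sequence of the ages of its records up to time $n$, and let $L_k^{(1)}(n)$ be the $k$th largest element of this sequence. Then the relative sizes of the ranked ages of records converge jointly in distribution, in the vague sense, $$\left(\frac{L^{(1)}_1(n)}{n},\frac{L^{(1)}_2(n)}{n},\dots\right)\stackrel{d}{\longrightarrow}\mathrm{PD}(1/2,0)\qquad\text{as } n\to\infty,$$ where $\mathrm{PD}(1/2,0)$ is the Poisson--Dirichlet distribution with parameters $(\alpha,\theta)=(1/2,0)$.
   Context: Setting. $\eta_1,\eta_2,\dots$ are i.i.d. real random variables with a symmetric continuous distribution, $X_0=0$, $X_n=X_{n-1}+\eta_n$. Record times: $t_1=0$ and $t_k=t_{k-1}+\min\{\tau>0:X_{t_{k-1}+\tau}>X_{t_{k-1}}\}$ for $k\ge2$. Ages of records: $\tau_k=t_{k+1}-t_k$, $k\ge1$. Number of records until time $n$: $R_n=m$ if and only if $t_m\le n<t_{m+1}$. Current age: $A_n=n-t_m$ if $R_n=m$. Elements of the sequence of ages are counted with multiplicity, and $L_k^{(1)}(n)=0$ if the sequence has fewer than $k$ elements. Poisson--Dirichlet distribution. For $0<\alpha<1$ and $\theta>-\alpha$, let $U_1,U_2,\dots$ be independent, $U_i$ having the beta distribution with parameters $(\theta+i\alpha,1-\alpha)$, and let $V_i=(1-U_i)\prod_{j=1}^{i-1}U_j$ for $i\ge1$.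 $\mathrm{PD}(\alpha,\theta)$ is the law of the sequence obtained by ranking $(V_i)_{i\ge1}$ in decreasing order ($(V_i)$ being then the size-biased permutation of the ranked sequence). The convergence is that of laws on $[0,1]^{\mathbb N}$ with the (compact metrizable) product topology, i.e. convergence of integrals of continuous functions; equivalently, convergence in distribution of $(L_1^{(1)}(n)/n,\dots,L_k^{(1)}(n)/n)$ to the first $k$ coordinates for each fixed $k$. *)

(* Defs.v *)
From HB Require Import structures.
From mathcomp Require Import all_boot all_order all_algebra.
From mathcomp Require Import finmap.
From mathcomp Require Import all_classical all_reals all_analysis.

Set Implicit Arguments.
Unset Strict Implicit.
Unset Printing Implicit Defensive.

Import Order.TTheory GRing.Theory Num.Theory.
Import numFieldNormedType.Exports.

Local Open Scope classical_set_scope.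
Local Open Scope ring_scope.

(** * Random variables *)

Section random_variables.
Context d (T : measurableType d) (R : realType) (P : probability T R).
Implicit Types (X : nat -> {RV P >-> R}) (Y : {RV P >-> R}).

Definition mutually_independent X : Prop :=
  forall (J : {fset nat}) (A : nat -> set R), (forall i, measurable (A i)) ->
    P (\bigcap_(i in [set` J]) (X i @^-1` A i)) =
    (\prod_(i <- J) P (X i @^-1` A i))%E.

Definition identically_distributed X : Prop :=
  forall i j (A : set R), measurable A ->
    distribution P (X i) A = distribution P (X j) A.

Definition symmetric_law Y : Prop :=
  forall A : set R, measurable A ->
    P [set w | A (Y w)] = P [set w | A (- Y w)].

(* No atoms; a density is not required. *)
Definition continuous_law Y : Prop := continuous (cdf Y).

Definition beta_density (a b x : R) : R :=
  x `^ (a - 1) * (1 - x) `^ (b - 1) /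
  \int[lebesgue_measure]_(y in `]0, 1[) (y `^ (a - 1) * (1 - y) `^ (b - 1)).

(* The library's [beta_prob] only has natural-number parameters.  The interval
   is open because [0 `^ r] is [0], not infinite, for [r < 0]. *)
Definition beta_law (a b : R) Y : Prop :=
  forall A : set R, measurable A ->
    distribution P Y A =
    (\int[lebesgue_measure]_(x in A `&` `]0%R, 1%R[) (beta_density a b x)%:E)%E.

End random_variables.

(** * Records of a path [x 0, x 1, ...] *)

Section records.
Context {R : realType}.
Implicit Types (x : nat -> R) (n k s : nat).

(* [e i] is the jump number [i + 1]. *)
Definition walk (e : nat -> R) n : R := \sum_(i < n) e i.

(* [None] stands for an infinite time. *)
Definition next_record x s : option nat :=
  if pselect (exists tau, (0 < tau)%N && (x s < x (s + tau)%N)) is left ex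
  then Some (s + ex_minn ex)%N else None.

(* [record_time x k] is t_(k+1). *)
Fixpoint record_time x k : option nat :=
  if k is k'.+1 then obind (next_record x) (record_time x k') else Some 0%N.

Definition reached (t : option nat) n : bool :=
  if t is Some s then (s <= n)%N else false.

(* R_n; [record_countP] below is its defining property.  At most [n + 1] record
   times are at most [n], since they are strictly increasing. *)
Definition record_count x n : nat :=
  count (fun k => reached (record_time x k) n) (iota 0 n.+1).

(* tau_(k+1); only used for record times that are finite. *)
Definition age x k : nat :=
  (odflt 0 (record_time x k.+1) - odflt 0 (record_time x k))%N.

(* A_n *)
Definition current_age x n : nat :=
  (n - odflt 0 (record_time x (record_count x n).-1))%N.

(* (tau_1, ..., tau_(m-1), A_n) with m = R_n *)
Definition ages x n : seq nat :=
  rcons [seq age x k | k <- iota 0 (record_count x n).-1] (current_age x n).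

(* [ranked_age x n k] is L_(k+1)(n), and is 0 beyond the number of ages. *)
Definition ranked_age x n k : nat := nth 0%N (sort geq (ages x n)) k.

Definition relative_ranked_ages x n : {ptws nat -> R} :=
  fun k => (ranked_age x n k)%:R / n%:R.

Lemma next_record_gt x s t : next_record x s = Some t -> (s < t)%N.
Proof.
rewrite /next_record; case: pselect => // ex [<-].
by case: ex_minnP => tau /andP[tau0 _] _; rewrite -[ltnLHS]addn0 ltn_add2l.
Qed.

Lemma reachedS x k n :
  reached (record_time x k.+1) n -> reached (record_time x k) n.
Proof.
rewrite /=; case: (record_time x k) => //= s.
case e: (next_record x s) => [t|]//= tn.
exact: leq_trans (ltnW (next_record_gt e)) tn.
Qed.

Lemma reached_le x j k n : (j <= k)%N ->
  reached (record_time x k) n -> reached (record_time x j) n.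
Proof.
move=> /subnK <-; elim: (k - j)%N => // i ih.
by rewrite addSn => /reachedS.
Qed.

Lemma record_time_ge x k s : record_time x k = Some s -> (k <= s)%N.
Proof.
elim: k s => // k ih s /=; case e: (record_time x k) => [t|]//= /next_record_gt.
exact: leq_ltn_trans (ih _ e).
Qed.

Lemma reached_leq x k n : reached (record_time x k) n -> (k <= n)%N.
Proof.
by case e: (record_time x k) => [s|]//=; apply: leq_trans (record_time_ge e).
Qed.

(* R_n = m if and only if t_m <= n < t_(m+1) *)
Lemma record_countP x n m :
  record_count x n = m.+1 <->
  reached (record_time x m) n /\ ~~ reached (record_time x m.+1) n.
Proof.
have cnt j : (j <= n)%N -> reached (record_time x j) n ->
    ~~ reached (record_time x j.+1) n -> record_count x n = j.+1.
  move=> jn rj nrj; rewrite /record_count.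
  have -> : n.+1 = (j.+1 + (n - j))%N by rewrite addSn subnKC.
  rewrite iotaD count_cat add0n.
  rewrite [X in (X + _)%N](_ : _ = j.+1); last first.
    rewrite -[RHS](size_iota 0); apply/eqP; rewrite -all_count.
    by apply/allP => i; rewrite mem_iota add0n ltnS /= => /reached_le; apply.
  rewrite [X in (_ + X)%N](_ : _ = 0%N) ?addn0//.
  apply/eqP; rewrite -leqn0 leqNgt -has_count -all_predC.
  apply/allP => i; rewrite mem_iota => /andP[ji _] /=.
  by apply: contra nrj; exact: reached_le.
split=> [cm|[rm nrm]]; last exact: cnt (reached_leq rm) rm nrm.
have ex : exists j, ~~ reached (record_time x j) n.
  by exists n.+1; apply/negP => /reached_leq; rewrite ltnn.
case: (ex_minnP ex) => -[//|j] nrj jmin.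
have rj : reached (record_time x j) n.
  by apply: contraT => /jmin; rewrite ltnn.
by have := cnt j (reached_leq rj) rj nrj; rewrite cm => -[->].
Qed.

End records.

(** * Laws of random sequences *)

(* The space of real sequences with the product topology and its Borel sets. *)
Notation sequence_space R := (g_sigma_algebraType (@open {ptws nat -> R})).

Definition unit_cube (R : realType) : set {ptws nat -> R} :=
  [set x | forall k, x k \in `[0, 1]].

(* Vague convergence, on the compact space [unit_cube], of the law of [X n] to
   [mu]. *)
Definition cvg_in_law d (T : measurableType d) (R : realType)
    (P : probability T R) (X : nat -> T -> {ptws nat -> R})
    (mu : probability (sequence_space R) R) : Prop :=
  forall f : {ptws nat -> R} -> R, {within @unit_cube R, continuous f} ->
    ('E_P[fun w => f (X n w)])%E @[n --> \oo] -->
    (\int[mu]_(x in @unit_cube R) (f x)%:E)%E.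

(* [u i] is U_(i+1) and [stick_breaking u i] is V_(i+1). *)
Definition stick_breaking (R : realType) (u : nat -> R) (i : nat) : R :=
  (1 - u i) * \prod_(j < i) u j.

Definition decreasing_rearrangement (R : realType) (v w : nat -> R) : Prop :=
  nonincreasing_seq w /\
  exists2 s : nat -> nat, bijective s & forall k, w k = v (s k).

(* [is_PD alpha theta mu]: [mu] is PD(alpha, theta).  The ranking is only
   required almost surely: off a null set the V_i are positive and sum to 1, so
   that they can be ranked. *)
Definition is_PD (R : realType) (alpha theta : R)
    (mu : probability (sequence_space R) R) : Prop :=
  [/\ 0 < alpha < 1, - alpha < theta &
  exists (d : measure_display) (T : measurableType d) (Q : probability T R)
    (U : nat -> {RV Q >-> R}) (W : {RV Q >-> sequence_space R}),
  [/\ mutually_independent U,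
      forall i, beta_law (theta + i.+1%:R * alpha) (1 - alpha) (U i),
      {ae Q, forall w,
        decreasing_rearrangement (stick_breaking (fun i => U i w)) (W w)} &
      forall A, measurable A -> mu A = distribution Q W A]].

(* Main.v *)
Require Import Defs.
From HB Require Import structures.
From mathcomp Require Import all_boot all_order all_algebra.
From mathcomp Require Import finmap.
From mathcomp Require Import all_classical all_reals all_analysis.
From mathcomp Require Import measurable_realfun.
From mathcomp Require Import zify ring lra.

Set Implicit Arguments.
Unset Strict Implicit.
Unset Printing Implicit Defensive.

Import Order.TTheory GRing.Theory Num.Theory.
Import numFieldNormedType.Exports.

Local Open Scope classical_set_scope.
Local Open Scope ring_scope.

(* The ages of the records form a renewal sequence.  Decomposing the path at
   its first maximum, and reversing it before that time, shows that the
   probability [q n] of no record up to time [n] satisfies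
   [\sum_(l <= n) q l * q (n - l) = 1], so that [q n] is the coefficient of [z^n]
   in [(1 - z)^(-1/2)], whatever the law of the jumps (Sparre Andersen).  The gap
   between records has the weight [record_gap l = q (l - 1) - q l], and
   [l * record_gap l = q (l - 1) / 2] makes the size-biased order of the ages
   explicit: what is left after each pick is a Polya-type (beta-binomial)
   variable.  A beta-binomial law is the mixture of binomial laws over the beta
   variable U_i, so for symmetric functions of the ages the expectation is that
   of binomial picks with parameters U_1, U_2, ...  By the law of large numbers
   for the binomial law these picks, divided by [n], are close to the sticks
   V_i, and ranking is 1-Lipschitz for the sup distance. *)

(** * Weights of the record ages *)

(** The ages come in order of time and the sticks in size-biased order, and nothing pathwise relates
    them; the walk and the U_i may live on unrelated probability spaces. Only expectations are
    compared: a symmetric function of the ages allows their reordering, and for every [n] and every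
    number of picks the mean over the walk equals, without error, the mean over the U_i of a
    conditional binomial mean. Picks stay computable because a removed part leaves one more cut in
    the composition, which raises the exponent of the generating function [(1-z)^(-(k+1)/2)] by one
    half. This is the origin of the parameters (i/2, 1/2) of U_i. Only finitely many picks are made
    explicit. What is left after K of them has relative size U_1 ... U_K, of mean 1/(K+1), so K is
    fixed large before [n] grows. The other error, from the binomial fluctuations, is known in mean
    square; hence the modulus of continuity of the form [e + C * r ^+ 2]. Test functions are made
    nonnegative by adding a constant, so that Tonelli's theorem applies throughout. *)

Section coefficients.
Context {R : realFieldType}.
Implicit Types (a b : R) (n l : nat).

(** The coefficient of [z^n] in [(1-z)^(-a)]; negative [a] is allowed, and [a = -1/2] serves for the
    gaps. *)
Definition neg_binom a n : R := \prod_(i < n) ((a + i%:R) / i.+1%:R).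

Lemma neg_binom0 a : neg_binom a 0 = 1.
Proof. by rewrite /neg_binom big_ord0. Qed.

Lemma neg_binomS a n : n.+1%:R * neg_binom a n.+1 = (a + n%:R) * neg_binom a n.
Proof.
rewrite /neg_binom big_ord_recr /= mulrCA mulrC; congr (_ * _).
by rewrite mulrCA mulfV ?mulr1// pnatr_eq0.
Qed.

Lemma neg_binom_gt0 a n : 0 < a -> 0 < neg_binom a n.
Proof.
by move=> a0; apply: prodr_gt0 => i _; rewrite divr_gt0// ltr_wpDr.
Qed.

Lemma neg_binom1 n : neg_binom 1 n = 1.
Proof.
by rewrite /neg_binom big1// => i _; rewrite -natr1 addrC divff// natr1 pnatr_eq0.
Qed.

Lemma neg_binomD1 a n : a != 0 -> a * neg_binom (a + 1) n = (a + n%:R) * neg_binom a n.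
Proof.
move=> a0; elim: n => [|n ih]; first by rewrite !neg_binom0 addr0.
have n0 : n.+1%:R != 0 :> R by rewrite pnatr_eq0.
apply: (mulfI n0); rewrite mulrCA neg_binomS mulrCA ih [RHS]mulrCA neg_binomS.
by rewrite -[n.+1%:R]natr1; ring.
Qed.

(** This is [(1-z)^(-a) (1-z)^(-b) = (1-z)^(-(a+b))]. Splitting the factor [n + 1] as
    [l + (n + 1 - l)], like the product rule, brings both sides to the recursion [neg_binomS]. *)
Lemma sum_neg_binomM a b n :
  \sum_(l < n.+1) neg_binom a l * neg_binom b (n - l) = neg_binom (a + b) n.
Proof.
elim: n => [|n ih]; first by rewrite big_ord1 !neg_binom0 mulr1.
have n0 : n.+1%:R != 0 :> R by rewrite pnatr_eq0.
apply: (mulfI n0); rewrite neg_binomS -ih !mulr_sumr.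
have -> : \sum_(i < n.+2) n.+1%:R * (neg_binom a i * neg_binom b (n.+1 - i)) =
    \sum_(i < n.+2) (i%:R * neg_binom a i) * neg_binom b (n.+1 - i) +
    \sum_(i < n.+2) neg_binom a i * ((n.+1 - i)%:R * neg_binom b (n.+1 - i)).
  rewrite -big_split; apply: eq_bigr => i _ /=.
  by rewrite natrB -1?ltnS//; ring.
rewrite big_ord_recl /= !mul0r add0r [X in _ + X]big_ord_recr /= subnn mul0r mulr0 addr0.
rewrite -big_split; apply: eq_bigr => i _ /=.
rewrite /bump add1n subSS neg_binomS subSn -1?ltnS// neg_binomS.
by rewrite natrB -1?ltnS//; ring.
Qed.

(* The half-integer case is forced by its self-convolution. *)
Lemma sqrt_convolution_unique (q : nat -> R) : q 0%N = 1 ->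
  (forall n, \sum_(l < n.+1) q l * q (n - l)%N = 1) ->
  forall n, q n = neg_binom (1 / 2) n.
Proof.
move=> q0 qq; elim/ltn_ind => -[_|n ih]; first by rewrite neg_binom0.
have := sum_neg_binomM (1 / 2) (1 / 2) n.+1.
rewrite (_ : 1 / 2 + 1 / 2 = 1); last by field.
have ends (u : nat -> R) :
    \sum_(l < n.+2) u l = u 0%N + \sum_(i < n) u i.+1 + u n.+1.
  by rewrite big_ord_recr big_ord_recl.
have := qq n.+1; rewrite neg_binom1 (ends (fun l => q l * q (n.+1 - l)%N)).
rewrite (ends (fun l => neg_binom _ l * neg_binom _ (n.+1 - l)%N)).
rewrite subn0 subnn !neg_binom0 q0.
have -> : \sum_(i < n) q i.+1 * q (n.+1 - i.+1)%N =
    \sum_(i < n) neg_binom (1 / 2) i.+1 * neg_binom (1 / 2) (n.+1 - i.+1)%N.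
  by apply: eq_bigr => i _; rewrite !ih//; have := ltn_ord i; lia.
by rewrite !mul1r !mulr1; lra.
Qed.

Definition record_gap l : R :=
  if l is l'.+1 then neg_binom (1 / 2) l' - neg_binom (1 / 2) l else 0.

(** Derivative of the generating function [1 - (1-z)^(1/2)] of the gaps; it also yields their
    nonnegativity. *)
Lemma record_gapE l : l%:R * record_gap l = 1 / 2 * (if l is l'.+1 then neg_binom (1 / 2) l' else 0).
Proof.
case: l => [|l] /=; first by rewrite mul0r mulr0.
by rewrite mulrBr neg_binomS -[l.+1%:R]natr1; field.
Qed.

Lemma record_gap_ge0 l : 0 <= record_gap l.
Proof.
case: l => // l; have l0 : 0 < l.+1%:R :> R by rewrite ltr0n.
rewrite -(pmulr_rge0 _ l0) record_gapE mulr_ge0 ?divr_ge0//.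
by apply/ltW/neg_binom_gt0; lra.
Qed.

Lemma record_gap_neg_binom l : record_gap l = (l == 0)%:R - neg_binom (- (1 / 2)) l.
Proof.
case: l => [|l]; first by rewrite neg_binom0 subrr.
have l0 : l.+1%:R != 0 :> R by rewrite pnatr_eq0.
apply: (mulfI l0); rewrite record_gapE /= sub0r mulrN neg_binomS.
have := @neg_binomD1 (- (1 / 2)) l; rewrite (_ : - (1 / 2) + 1 = 1 / 2); last by field.
rewrite oppr_eq0 mulf_eq0 oner_eq0 invr_eq0 pnatr_eq0 => /(_ isT) <-.
by field.
Qed.

(** Multiplication of [(1-z)^(-b)] by [1 - (1-z)^(1/2)]: a renewal step shifts the exponent by one
    half. *)
Lemma sum_record_gapM b n : \sum_(l < n.+1) record_gap l * neg_binom b (n - l) =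
  neg_binom b n - neg_binom (b - 1 / 2) n.
Proof.
under eq_bigr do rewrite record_gap_neg_binom mulrBl.
rewrite sumrB sum_neg_binomM addrC [- (1 / 2) + b]addrC addrC; congr (_ - _).
rewrite big_ord_recl /= mul1r subn0 big1 ?addr0// => i _.
by rewrite mul0r.
Qed.

End coefficients.

(** * Weighted compositions and their size-biased picks *)

Section compositions.
Context {R : realFieldType}.
Implicit Types (G H : seq nat -> R) (N m k l : nat).

Lemma exchange_triangle N (F : nat -> nat -> R) :
  \sum_(l < N.+1) \sum_(j < (N - l).+1) F l j =
  \sum_(j < N.+1) \sum_(l < (N - j).+1) F l j.
Proof.
have widen (F' : nat -> R) l : (l <= N)%N ->
  \sum_(j < (N - l).+1) F' j = \sum_(j < N.+1 | (l + j <= N)%N) F' j.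
  move=> lN; rewrite (big_ord_widen N.+1); last by rewrite ltnS leq_subr.
  by apply: eq_bigl => j; rewrite ltnS leq_subRL.
transitivity (\sum_(l < N.+1) \sum_(j < N.+1 | (l + j <= N)%N) F l j).
  by apply: eq_bigr => l _; apply: (widen (F l)); rewrite -ltnS.
rewrite (exchange_big_dep xpredT)//=.
apply: eq_bigr => j _; rewrite (widen (F^~ j)) -1?ltnS//.
by apply: eq_bigl => l; rewrite addnC.
Qed.

(* Sum of [G c] over the compositions [c] of [N] into [m] parts, each part [l]
   carrying the weight [record_gap l]. *)
Fixpoint comp_sum m N G : R :=
  if m is m'.+1 then
    \sum_(l < N.+1) record_gap l * comp_sum m' (N - l) (fun c => G ((l : nat) :: c))
  else (N == 0)%:R * G [::].

Lemma comp_sumS m N G : comp_sum m.+1 N G =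
  \sum_(l < N.+1) record_gap l * comp_sum m (N - l) (fun c => G ((l : nat) :: c)).
Proof. by []. Qed.

Lemma comp_sum0 N G : comp_sum 0 N G = (N == 0)%:R * G [::].
Proof. by []. Qed.

Arguments comp_sum : simpl never.

(** As [record_gap 0 = 0], every part that counts is at least 1; this truncates all sums over the
    number of parts. *)
Lemma comp_sum_lt m N G : (N < m)%N -> comp_sum m N G = 0.
Proof.
elim: m N G => // m ih N G Nm; rewrite comp_sumS; apply: big1 => -[[|l] lN] _ /=; first by rewrite mul0r.
by rewrite ih ?mulr0//; lia.
Qed.

Lemma eq_comp_sum m N G H : (forall c, sumn c = N -> G c = H c) ->
  comp_sum m N G = comp_sum m N H.
Proof.
elim: m N G H => [|m ih] N G H GH; rewrite ?comp_sum0 ?comp_sumS.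
  by have [N0|] := eqVneq N 0%N; rewrite ?mul0r// GH.
apply: eq_bigr => l _; congr (_ * _); apply: ih => c cN; apply: GH => /=.
by rewrite cN subnKC// -ltnS.
Qed.

Lemma comp_sum_linear m N G H (a : R) :
  comp_sum m N (fun c => a * G c + H c) = a * comp_sum m N G + comp_sum m N H.
Proof.
elim: m N G H => [|m ih] N G H; rewrite ?comp_sum0 ?comp_sumS; first by ring.
by rewrite mulr_sumr -big_split; apply: eq_bigr => l _ /=; rewrite ih; ring.
Qed.

Lemma comp_sum_ge0 m N G : (forall c, sumn c = N -> 0 <= G c) -> 0 <= comp_sum m N G.
Proof.
elim: m N G => [|m ih] N G G0; rewrite ?comp_sum0 ?comp_sumS.
  by have [N0|] := eqVneq N 0%N; rewrite ?mul0r// mul1r G0.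
apply: sumr_ge0 => l _; rewrite mulr_ge0 ?record_gap_ge0// ih// => c cN.
by apply: G0; rewrite /= cN subnKC// -ltnS.
Qed.

Definition perm_inv G := forall c c' : seq nat, perm_eq c c' -> G c = G c'.

Lemma perm_inv_cons G l : perm_inv G -> perm_inv (fun c => G (l :: c)).
Proof. by move=> PG c c' cc'; apply: PG; rewrite perm_cons. Qed.

(* By exchangeability each of the [m.+1] parts is equally likely to be the
   size-biased pick. *)
Lemma comp_sum_size_biased m N G : perm_inv G ->
  N%:R * comp_sum m.+1 N G =
  m.+1%:R * \sum_(l < N.+1) l%:R * record_gap l *
    comp_sum m (N - l) (fun c => G ((l : nat) :: c)).
Proof.
elim: m N G => [|m ih] N G PG.
  rewrite mul1r comp_sumS mulr_sumr; apply: eq_bigr => l _; rewrite comp_sum0.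
  have [lN|] := eqVneq (N - l)%N 0%N; last by rewrite !mul0r !mulr0.
  have Nl : N = l by have := ltn_ord l; lia.
  by rewrite [X in X * _](congr1 _ Nl) mulrA.
(* [N] is split into the first part [l] and the rest [N - l]: the biased part is the first one, or
   lies in the rest. In the second case the induction hypothesis brings it to second place, and
   symmetry of [G] swaps it to the front. *)
have -> : N%:R * comp_sum m.+2 N G =
    \sum_(l < N.+1) l%:R * record_gap l * comp_sum m.+1 (N - l) (fun c => G ((l : nat) :: c))
  + \sum_(l < N.+1) record_gap l * ((N - l)%:R * comp_sum m.+1 (N - l) (fun c => G ((l : nat) :: c))).
  rewrite -big_split comp_sumS mulr_sumr.
  apply: eq_bigr => l _; rewrite natrB -1?ltnS//.
  by move: (comp_sum m.+1 _ _) => C /=; ring.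
under [X in _ + X]eq_bigr do rewrite (ih _ _ (perm_inv_cons _ PG)).
have -> : \sum_(l < N.+1) record_gap l * (m.+1%:R * \sum_(j < (N - l).+1)
      j%:R * record_gap j * comp_sum m (N - l - j) (fun c => G [:: (l : nat), (j : nat) & c])) =
    m.+1%:R * \sum_(l < N.+1) \sum_(j < (N - l).+1)
      (j%:R * record_gap j * (record_gap l *
        comp_sum m (N - j - l) (fun c => G [:: (j : nat), (l : nat) & c]))).
  rewrite mulr_sumr; apply: eq_bigr => l _; rewrite !mulr_sumr.
  apply: eq_bigr => j _; rewrite -!subnDA addnC.
  rewrite (@eq_comp_sum m _ _ (fun c => G [:: (j : nat), (l : nat) & c])).
    by move: (comp_sum m _ _) => C; ring.
  by move=> c _; apply: PG; apply/permP => x /=; rewrite addnCA.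
rewrite (exchange_triangle N (fun l j => j%:R * record_gap j * (record_gap l *
      comp_sum m (N - j - l) (fun c => G [:: j, l & c])))).
rewrite -[m.+2%:R]natr1 mulrDl mul1r addrC; congr (_ * _ + _).
by apply: eq_bigr => l _; rewrite -mulr_sumr.
Qed.

(* The binomial coefficient counts the ways to cut a composition into [k.+1]
   (possibly empty) consecutive blocks, each a renewal bridge. *)
Definition bridge_sum k N G : R :=
  \sum_(m < N.+1) 'C(m + k, k)%:R * comp_sum m N G.

Lemma bridge_sum_widen M k N G : (N <= M)%N ->
  bridge_sum k N G = \sum_(m < M.+1) 'C(m + k, k)%:R * comp_sum m N G.
Proof.
move=> NM; rewrite /bridge_sum (big_ord_widen M.+1 (fun m => 'C(m + k, k)%:R * comp_sum m N G))//.
rewrite [RHS](bigID (fun m : 'I_M.+1 => (m < N.+1)%N)) /= [X in _ = _ + X]big1 ?addr0//.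
by move=> m mN; rewrite comp_sum_lt ?mulr0//; lia.
Qed.

(** The term [l = 0] vanishes, so the equation determines the value at [n] from earlier ones. *)
Lemma renewal_unique (x y z : nat -> R) :
  (forall n, x n - \sum_(l < n.+1) record_gap l * x (n - l)%N = z n) ->
  (forall n, y n - \sum_(l < n.+1) record_gap l * y (n - l)%N = z n) -> x =1 y.
Proof.
move=> xz yz; elim/ltn_ind => n ih.
have := xz n; rewrite -(yz n) !big_ord_recl /= !mul0r !add0r.
rewrite (eq_bigr (fun i : 'I_n => record_gap (bump 0 i) * y (n - bump 0 i)%N)).
  by move=> /addIr.
by move=> i _; rewrite ih//; have := ltn_ord i; rewrite /bump; lia.
Qed.

Lemma bridge_sum_first k n G : bridge_sum k n G = (n == 0)%:R * G [::] +
  \sum_(m < n.+1) 'C(m.+1 + k, k)%:R * comp_sum m.+1 n G.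
Proof.
rewrite (@bridge_sum_widen n.+1)// big_ord_recl /= comp_sum0 add0n binn mul1r.
by congr (_ + _); apply: eq_bigr.
Qed.

Lemma sum_record_gap_bridge k n G :
  \sum_(l < n.+1) record_gap l * bridge_sum k (n - l) (fun c => G ((l : nat) :: c)) =
  \sum_(m < n.+1) 'C(m + k, k)%:R * comp_sum m.+1 n G.
Proof.
under eq_bigr do rewrite (@bridge_sum_widen n) ?leq_subr// mulr_sumr.
rewrite exchange_big; apply: eq_bigr => m _; rewrite comp_sumS mulr_sumr.
by apply: eq_bigr => l _; rewrite mulrCA.
Qed.

Lemma bridge_sum0_renewal n G : bridge_sum 0 n G = (n == 0)%:R * G [::] +
  \sum_(l < n.+1) record_gap l * bridge_sum 0 (n - l) (fun c => G ((l : nat) :: c)).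
Proof.
rewrite bridge_sum_first sum_record_gap_bridge; congr (_ + _).
by apply: eq_bigr => m _; rewrite !addn0 !bin0.
Qed.

(** Pascal's rule. In generating functions, [F] being that of the gaps, [B_k (1 - F) = B_(k-1)] and
    [B_0 (1 - F) = 1]. As [1 - F = (1-z)^(1/2)], the value of [bridge_sum1] follows. *)
Lemma bridge_sum_renewal k n :
  bridge_sum k n (fun=> 1) - \sum_(l < n.+1) record_gap l * bridge_sum k (n - l) (fun=> 1) =
  if k is k'.+1 then bridge_sum k' n (fun=> 1) else (n == 0)%:R.
Proof.
rewrite (sum_record_gap_bridge k n (fun=> 1)) bridge_sum_first mulr1 -addrA -sumrB.
case: k => [|k].
  by rewrite big1 ?addr0// => m _; rewrite !addn0 !bin0 subrr.
rewrite bridge_sum_first mulr1; congr (_ + _); apply: eq_bigr => m _.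
by rewrite -mulrBl addSn addnS binS natrD addrAC subrr add0r addSn.
Qed.

Lemma bridge_sum1 k n : bridge_sum k n (fun=> 1) = neg_binom (k.+1%:R / 2) n.
Proof.
elim: k n => [|k ih] n.
  move: n; apply: (@renewal_unique (fun n => bridge_sum 0 n (fun=> 1)) _
    (fun n => (n == 0)%:R)) => m.
    exact: bridge_sum_renewal.
  rewrite sum_record_gapM opprB addrC subrK subrr.
  case: m => [|m]; first by rewrite neg_binom0.
  by rewrite /neg_binom big_ord_recl /= addr0 !mul0r.
move: n; apply: (@renewal_unique (fun n => bridge_sum k.+1 n (fun=> 1)) _
  (neg_binom (k.+1%:R / 2))) => m.
  by rewrite bridge_sum_renewal ih.
rewrite sum_record_gapM opprB addrC subrK; congr neg_binom.
by rewrite -[k.+2%:R]natr1; field.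
Qed.

(** The place of the removed part becomes an additional cut. Counting pairs of a cutting and a part
    gives [(m+1) C(m+1+k, k) = (k+1) C(m+k+1, k+1)]: any of the [k + 1] cuts left may be the new
    one. So the picks never leave the family [bridge_sum k]. *)
Lemma bridge_sum_size_biased k N G : perm_inv G ->
  N.+1%:R * bridge_sum k N.+1 G = k.+1%:R / 2 *
  \sum_(l < N.+1) neg_binom (1 / 2) l * bridge_sum k.+1 (N - l) (fun c => G (l.+1 :: c)).
Proof.
move=> PG; rewrite [in LHS]/bridge_sum big_ord_recl comp_sum0 mul0r mulr0 add0r mulr_sumr.
transitivity (\sum_(m < N.+1) \sum_(l < N.+2) 'C(m.+1 + k, k)%:R * m.+1%:R *
    (l%:R * record_gap l * comp_sum m (N.+1 - l) (fun c => G ((l : nat) :: c)))).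
  apply: eq_bigr => m _; rewrite -mulr_sumr -mulrA -comp_sum_size_biased//.
  by rewrite mulrCA.
rewrite exchange_big big_ord_recl /= big1 ?add0r; last first.
  by move=> m _; rewrite !mul0r mulr0.
rewrite mulr_sumr; apply: eq_bigr => l _.
rewrite (@bridge_sum_widen N) ?leq_subr// !mulr_sumr.
apply: eq_bigr => m _; rewrite /bump leq0n add1n subSS record_gapE.
have -> : 'C(m.+1 + k, k)%:R * m.+1%:R = k.+1%:R * 'C(m + k.+1, k.+1)%:R :> R.
  by rewrite -!natrM addnS -addSn mul_bin_left addnK mulnC.
by move: (comp_sum _ _ _) => C; field.
Qed.

Definition bridge_mean k N G : R := bridge_sum k N G / neg_binom (k.+1%:R / 2) N.

(** The beta-binomial law with [M] trials and parameters [((i+1)/2, 1/2)], those of U_(i+1). Here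
    [j] is the mass left after the pick. *)
Definition polya_weight i M j : R :=
  neg_binom (i.+1%:R / 2) j * neg_binom (1 / 2) (M - j) / neg_binom (i.+2%:R / 2) M.

Lemma bridge_mean0 k G : bridge_mean k 0 G = G [::].
Proof.
by rewrite /bridge_mean /bridge_sum big_ord1 neg_binom0 comp_sum0 binn !mul1r divr1.
Qed.

Let neg_binom_neq0 k N : neg_binom (k.+1%:R / 2) N != 0 :> R.
Proof. by rewrite gt_eqF// neg_binom_gt0// divr_gt0. Qed.

(** A completed age is at least 1. One unit of the picked part is thus forced, and only [N] of the
    [N + 1] units are trials. *)
Lemma bridge_meanS k N G : perm_inv G ->
  bridge_mean k N.+1 G = \sum_(j < N.+1) polya_weight k.+1 N j *
    bridge_mean k.+1 j (fun c => G ((N.+1 - j)%N :: c)).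
Proof.
move=> PG; have N0 : N.+1%:R != 0 :> R by rewrite pnatr_eq0.
have k0 : k.+1%:R != 0 :> R by rewrite pnatr_eq0.
have {}PG := bridge_sum_size_biased k N PG.
rewrite /bridge_mean; apply: (mulfI N0); rewrite mulrA PG.
have nbE : N.+1%:R * neg_binom (k.+1%:R / 2) N.+1 =
    k.+1%:R / 2 * neg_binom (k.+3%:R / 2) N :> R.
  rewrite neg_binomS -neg_binomD1 ?mulf_neq0 ?invr_eq0 ?pnatr_eq0//.
  by congr (_ * neg_binom _ _); rewrite -[k.+3%:R]natr1 -[k.+2%:R]natr1; field.
have -> : neg_binom (k.+1%:R / 2) N.+1 =
    k.+1%:R / 2 * neg_binom (k.+3%:R / 2) N / N.+1%:R :> R.
  by rewrite -nbE mulrAC mulfV// mul1r.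
rewrite (reindex_inj rev_ord_inj) /= !mulr_sumr mulr_suml; apply: eq_bigr => j _.
have jN : (j <= N)%N by rewrite -ltnS.
rewrite /polya_weight subSS subKn// -subSn//.
have := neg_binom_neq0 k.+2 N; have := neg_binom_neq0 k.+1 j.
move: (neg_binom (k.+3%:R / 2) N) => x.
move: (neg_binom (k.+2%:R / 2) j) (neg_binom (1 / 2) (N - j)) => y z.
move: (bridge_sum _ _ _) => b y0 x0.
by field; rewrite x0 y0 !nat1r N0 k0.
Qed.

Lemma bridge_mean1 k N : bridge_mean k N (fun=> 1) = 1.
Proof. by rewrite /bridge_mean bridge_sum1 divff. Qed.

Lemma bridge_mean_linear k N G H (a : R) :
  bridge_mean k N (fun c => a * G c + H c) = a * bridge_mean k N G + bridge_mean k N H.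
Proof.
rewrite /bridge_mean mulrA -mulrDl; congr (_ / _).
rewrite /bridge_sum mulr_sumr -big_split; apply: eq_bigr => m _ /=.
by rewrite comp_sum_linear; move: (comp_sum _ _ _) (comp_sum _ _ _) => x y; ring.
Qed.

Lemma bridge_mean_ge0 k N G : (forall c, sumn c = N -> 0 <= G c) ->
  0 <= bridge_mean k N G.
Proof.
move=> G0; apply: divr_ge0; last by apply/ltW/neg_binom_gt0/divr_gt0.
by apply: sumr_ge0 => m _; rewrite mulr_ge0// comp_sum_ge0.
Qed.

(** The mean of [G] over the ages at time [n]: [a] is the current age, weighted by the probability
    of no record in [a] steps, and the composition of [n - a] lists the completed ages. *)
Definition renewal_mean n G : R := \sum_(a < n.+1)
  neg_binom (1 / 2) a * bridge_sum 0 (n - a) (fun c => G (rcons c a)).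

Lemma renewal_mean_first n G : renewal_mean n G = neg_binom (1 / 2) n * G [:: n] +
  \sum_(l < n.+1) record_gap l * renewal_mean (n - l) (fun c => G ((l : nat) :: c)).
Proof.
rewrite /renewal_mean.
under [in LHS]eq_bigr do rewrite bridge_sum0_renewal mulrDr mulr_sumr.
rewrite big_split /=; congr (_ + _).
  rewrite big_ord_recr /= subnn big1 ?add0r ?[(0 == 0)%:R * _]mul1r// => a _.
  by rewrite subn_eq0 leqNgt ltn_ord mul0r mulr0.
under [RHS]eq_bigr do rewrite mulr_sumr.
rewrite (exchange_triangle n (fun a l => neg_binom (1 / 2) a * (record_gap l *
  bridge_sum 0 (n - a - l) (fun c => G (rcons (l :: c) a))))).
by apply: eq_bigr => l _; apply: eq_bigr => a _; rewrite mulrCA subnAC.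
Qed.

(** The current age plays the role of the first size-biased pick, with the discrete arcsine law (the
    denominator of [polya_weight 0 n] is [neg_binom 1 n = 1]). It may be 0, so here all [n] units
    are trials. *)
Lemma renewal_meanE n G : perm_inv G -> renewal_mean n G =
  \sum_(j < n.+1) polya_weight 0 n j * bridge_mean 0 j (fun c => G ((n - j)%N :: c)).
Proof.
move=> PG; rewrite /renewal_mean (reindex_inj rev_ord_inj) /=; apply: eq_bigr => j _.
have jn : (j <= n)%N by rewrite -ltnS.
rewrite subSS subKn// /polya_weight /bridge_mean divff ?pnatr_eq0// neg_binom1 divr1.
rewrite [RHS]mulrC mulrA divfK ?gt_eqF ?neg_binom_gt0 ?divr_gt0// mulrC; congr (_ * _).
by apply: eq_bigr => m _; congr (_ * _); apply: eq_comp_sum => c _; apply: PG; rewrite perm_rcons.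
Qed.

End compositions.

(** * Independence and the cylinder sigma-algebra *)

Section cylinders.
Context {R : realType}.
Implicit Types D : set nat.

(** [D] records which coordinates an event depends on. Disjoint blocks of jumps become two
    sigma-algebras on one path space, so the same path can be fed to both. *)
Definition cylinder D : set (set (nat -> R)) :=
  [set C | exists2 J : {fset nat}, [set` J] `<=` D &
    exists2 A : nat -> set R, (forall i, measurable (A i)) &
      C = [set x | forall i, i \in J -> A i (x i)]].

Lemma cylinder_setI D : setI_closed (cylinder D).
Proof.
move=> _ _ [J1 J1D [A1 mA1 ->]] [J2 J2D [A2 mA2 ->]].
exists (J1 `|` J2)%fset.
  by move=> i /=; rewrite inE => /orP[/J1D|/J2D].
exists (fun i => (if i \in J1 then A1 i else setT) `&` (if i \in J2 then A2 i else setT)).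
  by move=> i; apply: measurableI; case: ifP.
apply/seteqP; split => x /=.
  move=> [x1 x2] i iJ; split; case: ifP => //; [exact: x1|exact: x2].
move=> h; split => i iJ; have := h i; rewrite inE iJ ?orbT => /(_ isT)[] //.
Qed.

Lemma cylinder_setT D : cylinder D setT.
Proof.
exists fset0; first by move=> i.
by exists (fun=> setT) => //; apply/seteqP; split.
Qed.

Notation seqs D := (g_sigma_algebraType (cylinder D)).

Lemma measurable_coordinate D i : D i ->
  measurable_fun setT (fun x : seqs D => x i).
Proof.
move=> Di _ A mA; rewrite setTI; apply: sub_gen_smallest.
exists [fset i]%fset; first by move=> j /=; rewrite inE => /eqP ->.
exists (fun=> A) => //; apply/seteqP; split => x /=.
  by move=> Ax j; rewrite inE => /eqP ->.
by apply; rewrite inE.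
Qed.

Lemma measurable_path D d (T : measurableType d) (X : T -> nat -> R) :
  (forall i, D i -> measurable_fun setT (fun w => X w i)) ->
  measurable_fun setT (X : T -> seqs D).
Proof.
move=> mX; apply: (@measurability _ _ T (seqs D) setT X (cylinder D)) => //.
move=> _ [_ [J JD [A mA ->]] <-]; rewrite setTI.
have -> : X @^-1` [set x | forall i, i \in J -> A i (x i)] =
    \bigcap_(i in [set` J]) ((fun w => X w i) @^-1` A i).
  by apply/seteqP; split => w /=.
apply: fin_bigcap_measurable => // i iJ.
by rewrite -[X in measurable X]setTI; apply: mX => //; exact: JD.
Qed.

End cylinders.
Notation seqs D := (g_sigma_algebraType (cylinder D)).

Section independence.
Context d (T : measurableType d) (R : realType) (P : probability T R).
Implicit Types (X : nat -> {RV P >-> R}) (D : set nat).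

Definition path_of X (w : T) : nat -> R := fun i => X i w.

Lemma measurable_path_of X D : measurable_fun setT (path_of X : T -> seqs D).
Proof. by apply: measurable_path => i _. Qed.

Lemma measurable_path_preimage X D (E : set (nat -> R)) :
  measurable (E : set (seqs D)) -> measurable (path_of X @^-1` E).
Proof.
by move=> mE; rewrite -[X in measurable X]setTI; exact: (@measurable_path_of X D measurableT E mE).
Qed.

Lemma path_cylinder X (J : {fset nat}) (A : nat -> set R) :
  path_of X @^-1` [set x | forall i, i \in J -> A i (x i)] =
  \bigcap_(i in [set` J]) (X i @^-1` A i).
Proof. by apply/seteqP; split => w /=. Qed.

Lemma cylinder_independent X D1 D2 (C1 C2 : set (nat -> R)) :
  mutually_independent X -> D1 `&` D2 = set0 ->
  cylinder D1 C1 -> cylinder D2 C2 ->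
  P (path_of X @^-1` (C1 `&` C2)) =
  (P (path_of X @^-1` C1) * P (path_of X @^-1` C2))%E.
Proof.
move=> iX D12 [J1 J1D [A1 mA1 ->]] [J2 J2D [A2 mA2 ->]].
have dJ : [disjoint J1 & J2]%fset.
  apply/fdisjointP => i iJ1; apply/negP => iJ2.
  have : (D1 `&` D2) i by split; [exact: J1D|exact: J2D].
  by rewrite D12.
pose A i := if i \in J1 then A1 i else A2 i.
have AJ2 i : i \in J2 -> A i = A2 i.
  by rewrite /A; case: ifPn => // /(fdisjointP dJ)/negPf ->.
have -> : [set x : nat -> R | forall i, i \in J1 -> A1 i (x i)] `&`
    [set x | forall i, i \in J2 -> A2 i (x i)] =
    [set x | forall i, i \in (J1 `|` J2)%fset -> A i (x i)].
  apply/seteqP; split => x /=.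
    move=> [x1 x2] i; rewrite inE /A; case: ifPn => [/x1//|_ /= /x2//].
  move=> h; split => i iJ; have := h i; rewrite inE iJ ?orbT => /(_ isT).
    by rewrite /A iJ.
  by rewrite AJ2.
rewrite !path_cylinder !iX//; last by move=> i; rewrite /A; case: ifP.
rewrite (@perm_big _ _ _ _ (J1 `|` J2)%fset (J1 ++ J2))/=; last first.
  apply: uniq_perm; rewrite ?cat_uniq ?fset_uniq ?andbT//=.
    by apply/hasPn => i /= iJ2; apply: contraTN iJ2 => /(fdisjointP dJ).
  by move=> i; rewrite inE mem_cat.
rewrite big_cat/=; congr (_ * _)%E; apply: eq_big_seq => i iJ; last by rewrite AJ2.
by rewrite /A iJ.
Qed.

Lemma cylinder_dynkin D (Q : set (nat -> R) -> Prop) :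
  (forall C, cylinder D C -> Q C) ->
  (forall E, measurable (E : set (seqs D)) -> Q E -> Q (~` E)) ->
  (forall F : (set (nat -> R))^nat, (forall n, measurable (F n : set (seqs D))) ->
    trivIset setT F -> (forall n, Q (F n)) -> Q (\bigcup_k F k)) ->
  forall E, measurable (E : set (seqs D)) -> Q E.
Proof.
move=> QC Qc Qu E mE; apply: (@dynkin_induction _ (seqs D) (cylinder D)) => //.
- exact: cylinder_setI.
- exact/QC/cylinder_setT.
Qed.

Lemma trivIset_preimage (T1 T2 : Type) (g : T1 -> T2) (F : nat -> set T2) :
  trivIset setT F -> trivIset setT (fun n => g @^-1` F n).
Proof. by move=> tF i j _ _ [w [Fi Fj]]; apply: tF => //; exists (g w). Qed.

Let P_fin (A : set T) : measurable A -> P A \is a fin_num.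
Proof. exact: fin_num_measure. Qed.

Lemma independent_dynkin X D (B : set T) : measurable B ->
  (forall C, cylinder D C -> P (path_of X @^-1` C `&` B) = (P (path_of X @^-1` C) * P B)%E) ->
  forall E, measurable (E : set (seqs D)) ->
  P (path_of X @^-1` E `&` B) = (P (path_of X @^-1` E) * P B)%E.
Proof.
move=> mB hC; apply: cylinder_dynkin => //.
- move=> E mE hE; have mXE := measurable_path_preimage X mE.
  have -> : path_of X @^-1` (~` E) = ~` (path_of X @^-1` E) by [].
  rewrite probability_setC// muleBl ?mul1e ?P_fin ?fin_num_adde_defl//; last first.
    by rewrite fin_numN P_fin.
  rewrite -hE setIC -setDE measureD// ?(le_lt_trans (probability_le1 _ _)) ?ltry//.
  by rewrite setIC.
- move=> F mF tF hF; rewrite preimage_bigcup setI_bigcupl.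
  have mXF n := measurable_path_preimage X (mF n).
  rewrite measure_bigcup//=; last 2 first.
  + by move=> n _; exact: measurableI.
  + by apply: trivIset_setIr; exact: trivIset_preimage.
  rewrite measure_bigcup//=; last exact: trivIset_preimage.
  rewrite muleC -(fineK (P_fin mB)) -nneseriesZl//; apply: eq_eseriesr => n _.
  by rewrite hF muleC fineK// P_fin.
Qed.

Lemma measurable_cylinder D (C : set (nat -> R)) : cylinder D C -> measurable (C : set (seqs D)).
Proof. exact: sub_gen_smallest. Qed.

Lemma independent_events X D1 D2 (E1 E2 : set (nat -> R)) :
  mutually_independent X -> D1 `&` D2 = set0 ->
  measurable (E1 : set (seqs D1)) -> measurable (E2 : set (seqs D2)) ->
  P (path_of X @^-1` E1 `&` path_of X @^-1` E2) =
  (P (path_of X @^-1` E1) * P (path_of X @^-1` E2))%E.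
Proof.
move=> iX D12 mE1 mE2.
(* The Dynkin argument is run once per event: on [E1] with [E2] fixed, then on [E2] with a cylinder
   [C1] fixed. *)
apply: independent_dynkin mE1; first exact: measurable_path_preimage mE2.
move=> C1 cC1; rewrite setIC muleC; apply: independent_dynkin mE2.
  exact: measurable_path_preimage (measurable_cylinder cC1).
move=> C2 cC2; rewrite -preimage_setI.
by apply: cylinder_independent cC2 cC1 => //; rewrite setIC.
Qed.

End independence.

(** Path events cannot tell apart independent sequences with equal marginals. This is applied to the
    shifted jumps and to the reversed, negated ones. *)
Lemma independent_law_unique d (T : measurableType d) d' (T' : measurableType d')
    (R : realType) (P : probability T R) (P' : probability T' R)
    (X : nat -> {RV P >-> R}) (X' : nat -> {RV P' >-> R}) (D : set nat) :
  mutually_independent X -> mutually_independent X' ->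
  (forall i A, measurable A -> P (X i @^-1` A) = P' (X' i @^-1` A)) ->
  forall E, measurable (E : set (seqs D)) ->
  P (path_of X @^-1` E) = P' (path_of X' @^-1` E).
Proof.
move=> iX iX' XX'; apply: cylinder_dynkin.
- move=> _ [J _ [A mA ->]]; rewrite !path_cylinder iX// iX'//.
  by apply: eq_bigr => i _; exact: XX'.
- move=> E mE hE.
  have -> : path_of X @^-1` (~` E) = ~` (path_of X @^-1` E) by [].
  have -> : path_of X' @^-1` (~` E) = ~` (path_of X' @^-1` E) by [].
  by rewrite !probability_setC ?hE//; exact: measurable_path_preimage mE.
- move=> F mF tF hF; rewrite !preimage_bigcup.
  rewrite !measure_bigcup//=; try exact: trivIset_preimage;
    try by move=> n _; exact: measurable_path_preimage (mF n).
  by apply: eq_eseriesr => n _; exact: hF.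
Qed.

Section independent_integral.
Context d (T : measurableType d) (R : realType) (P : probability T R).
Context d1 (T1 : measurableType d1) d2 (T2 : measurableType d2).

Lemma independent_pair_integral (Z1 : {mfun T >-> T1}) (Z2 : {mfun T >-> T2})
    (f : T1 * T2 -> \bar R) :
  (forall A B, measurable A -> measurable B ->
    P (Z1 @^-1` A `&` Z2 @^-1` B) = (P (Z1 @^-1` A) * P (Z2 @^-1` B))%E) ->
  measurable_fun setT f -> (forall z, 0 <= f z)%E ->
  (\int[P]_w f (Z1 w, Z2 w) = \int[P]_w \int[P]_w' f (Z1 w, Z2 w'))%E.
Proof.
move=> Z12 mf f0.
have mZ : measurable_fun setT (fun w => (Z1 w, Z2 w)).
  by apply/measurable_fun_pairP; split.
pose Z : {mfun T >-> (T1 * T2)%type} := HB.pack (fun w => (Z1 w, Z2 w))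
  (isMeasurableFun.Build _ _ _ _ _ mZ).
transitivity (\int[distribution P Z]_z f z)%E.
  by rewrite ge0_integral_distribution.
transitivity (\int[distribution P Z1 \x distribution P Z2]_z f z)%E.
  apply: eq_measure_integral => A mA _; apply/esym.
  by apply: product_measure_unique.
rewrite fubini_tonelli1//.
rewrite ge0_integral_distribution//; last first.
  by move=> x; apply: integral_ge0.
  exact: measurable_fun_fubini_tonelli_F.
apply: eq_integral => w _ /=; rewrite /fubini_F ge0_integral_distribution//.
exact: measurableT_comp.
Qed.

End independent_integral.

Section independent_blocks.
Context d (T : measurableType d) (R : realType) (P : probability T R).
Context (X : nat -> {RV P >-> R}) (iX : mutually_independent X).

Lemma independent_block_integral D1 D2 (f : seqs D1 * seqs D2 -> \bar R) :
  D1 `&` D2 = set0 ->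
  measurable_fun setT f -> (forall z, 0 <= f z)%E ->
  (\int[P]_w f (path_of X w, path_of X w) =
   \int[P]_w \int[P]_w' f (path_of X w, path_of X w'))%E.
Proof.
move=> D12 mf f0.
pose Z D : {mfun T >-> seqs D} := HB.pack (path_of X)
  (isMeasurableFun.Build _ _ _ _ _ (@measurable_path_of _ _ _ _ X D)).
apply: (@independent_pair_integral _ _ _ _ _ _ _ _ (Z D1) (Z D2)) => // A B mA mB.
exact: (independent_events iX D12 mA mB).
Qed.

Lemma independent_integralM D1 D2 (f1 : seqs D1 -> \bar R) (f2 : seqs D2 -> \bar R) :
  D1 `&` D2 = set0 ->
  measurable_fun setT f1 -> (forall z, 0 <= f1 z)%E ->
  measurable_fun setT f2 -> (forall z, 0 <= f2 z)%E ->
  (\int[P]_w (f1 (path_of X w) * f2 (path_of X w)) =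
   \int[P]_w f1 (path_of X w) * \int[P]_w f2 (path_of X w))%E.
Proof.
move=> D12 mf1 f10 mf2 f20.
rewrite (@independent_block_integral D1 D2 (fun z => f1 z.1 * f2 z.2)%E)//=; last 2 first.
- by apply: emeasurable_funM; exact: measurableT_comp.
- by move=> z; exact: mule_ge0.
have mfX D (f : seqs D -> \bar R) : measurable_fun setT f ->
    measurable_fun setT (fun w => f (path_of X w)).
  by move=> mf; apply: measurableT_comp mf _; exact: measurable_path_of.
rewrite -ge0_integralZr//; [|exact: (mfX D1)|exact: integral_ge0].
by apply: eq_integral => w _; rewrite ge0_integralZl//; exact: (mfX D2).
Qed.

End independent_blocks.

(** * The law of the ages of records *)

Section record_paths.
Context {R : realType}.
Implicit Types (x y e : nat -> R) (n k s l : nat).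

Lemma next_record_some x s t : (s < t)%N -> x s < x t ->
  (forall u, (s < u < t)%N -> x u <= x s) -> next_record x s = Some t.
Proof.
move=> st xst mint; rewrite /next_record; case: pselect => [ex|[]]; last first.
  by exists (t - s)%N; rewrite subn_gt0 st subnKC// ltnW.
case: ex_minnP => tau /andP[tau0 xtau] min_tau; congr Some.
have : (tau <= t - s)%N by apply: min_tau; rewrite subn_gt0 st subnKC// ltnW.
case: (ltnP (s + tau) t) => [lt_t|]; last by lia.
by have := mint (s + tau)%N; rewrite lt_t -[X in (X < _)%N]addn0 ltn_add2l tau0 leNgt xtau => /(_ isT).
Qed.

Lemma next_record_None x s : (forall u, (s < u)%N -> x u <= x s) ->
  next_record x s = None.
Proof.
move=> xs; rewrite /next_record; case: pselect => // ex; exfalso; case: ex => tau /andP[tau0].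
by rewrite ltNge xs// -[X in (X < _)%N]addn0 ltn_add2l.
Qed.

Lemma next_recordP x s : if next_record x s is Some t
  then [/\ (s < t)%N, x s < x t & forall u, (s < u < t)%N -> x u <= x s]
  else forall u, (s < u)%N -> x u <= x s.
Proof.
rewrite /next_record; case: pselect => [ex|nex]; last first.
  move=> u su; rewrite leNgt; apply/negP => xsu; apply: nex.
  by exists (u - s)%N; rewrite subn_gt0 su subnKC// ltnW.
case: ex_minnP => tau /andP[tau0 xtau] min_tau; split => //.
  by rewrite -[X in (X < _)%N]addn0 ltn_add2l.
move=> u /andP[su utau]; rewrite leNgt; apply/negP => xsu.
have := min_tau (u - s)%N; rewrite subn_gt0 su (subnKC (ltnW su)) xsu => /(_ isT).
lia.
Qed.

(** Records depend only on the order of the values, so it is the orders of [x] and [y] that are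
    compared; the restarted walk differs from the original by a constant. *)
Lemma next_record_shift x y l s : (forall i j, (x (l + i)%N <= x (l + j)%N) = (y i <= y j)) ->
  next_record x (l + s) = omap (addn l) (next_record y s).
Proof.
move=> xy; have := next_recordP y s.
case: next_record => [t [st yst mint]|yu] /=.
  apply: next_record_some; rewrite ?ltn_add2l// ?ltNge ?xy -?ltNge//.
  by move=> u us; rewrite -(@subnKC l u) ?xy ?mint//; lia.
by apply: next_record_None => u lsu; rewrite -(@subnKC l u) ?xy ?yu//; lia.
Qed.

Lemma ages_no_record x n : (forall i, (0 < i <= n)%N -> x i <= x 0%N) -> ages x n = [:: n].
Proof.
move=> x0; have c1 : record_count x n = 1%N.
  apply/record_countP; split => //=.
  have := next_recordP x 0; case: next_record => //= t [t0 xt _].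
  by apply/negP => tn; move: xt; rewrite ltNge x0// t0.
by rewrite /ages /current_age c1 /= subn0.
Qed.

Lemma record_count_gt0 x n : (0 < record_count x n)%N.
Proof. by rewrite /record_count /=. Qed.

Lemma ages_first_record x y l n : (0 < l <= n)%N -> x 0%N < x l ->
  (forall i, (0 < i < l)%N -> x i <= x 0%N) ->
  (forall i j, (x (l + i)%N <= x (l + j)%N) = (y i <= y j)) ->
  ages x n = l :: ages y (n - l).
Proof.
move=> /andP[l0 ln] x0l xl xy.
have first : next_record x 0 = Some l by exact: next_record_some.
have rt k : record_time x k.+1 = omap (addn l) (record_time y k).
  elim: k => [|k ih]; first by rewrite /= first addn0.
  rewrite /= -/(record_time x k.+1) ih; case: (record_time y k) => //= s.
  exact: next_record_shift.
have reachedE k : reached (record_time x k.+1) n = reached (record_time y k) (n - l).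
  by rewrite rt; case: (record_time y k) => //= s; rewrite leq_subRL.
have [m ym] : exists m, record_count y (n - l) = m.+1.
  by exists (record_count y (n - l)).-1; rewrite prednK ?record_count_gt0.
have [ryl nryl] := (record_countP _ _ _).1 ym.
have xm : record_count x n = m.+2 by apply/record_countP; rewrite !reachedE.
(* [age] reads an infinite record time as 0, so the shift by [l] cancels in an age only when both
   record times are finite. *)
have finite k : (k <= m)%N -> exists s, record_time y k = Some s.
  move=> km; have := reached_le km ryl.
  by case: (record_time y k) => // s _; exists s.
rewrite /ages xm ym /= -/(age x 0) -[iota 1 m]/(iota (1 + 0) m) iotaDl -map_comp -rcons_cons /=.
congr (rcons (_ :: _) _).
- by rewrite /age rt /= addn0 subn0.
- apply/eq_in_map => k; rewrite mem_iota add0n => /andP[_ km] /=.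
  have [s sE] := finite k (ltnW km); have [t tE] := finite k.+1 km.
  rewrite /age !rt sE tE /=; lia.
- rewrite /current_age xm ym /= -/(record_time x m.+1) rt.
  by have [s ->] := finite m (leqnn _); rewrite /= subnDA.
Qed.

Definition shift_seq l e : nat -> R := fun i => e (l + i)%N.

Lemma walk_shift l e i : walk (shift_seq l e) i = walk e (l + i) - walk e l.
Proof.
elim: i => [|i ih]; first by rewrite addn0 subrr /walk big_ord0.
rewrite addnS /walk !big_ord_recr /= -/(walk (shift_seq l e) i) -/(walk e (l + i)) ih.
by rewrite addrAC.
Qed.

Lemma walk0 e : walk e 0 = 0.
Proof. by rewrite /walk big_ord0. Qed.

Definition no_record n : set (nat -> R) :=
  [set e | forall i, (0 < i <= n)%N -> walk e i <= 0].

Definition first_record l : set (nat -> R) :=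
  [set e | 0 < walk e l /\ forall i, (0 < i < l)%N -> walk e i <= 0].

Lemma walk_ages_no_record n e : no_record n e -> ages (walk e) n = [:: n].
Proof. by move=> ne; apply: ages_no_record => i /ne; rewrite walk0. Qed.

Lemma walk_ages_first_record l n e : (l <= n)%N -> first_record l e ->
  ages (walk e) n = l :: ages (walk (shift_seq l e)) (n - l).
Proof.
move=> ln [el ei]; apply: ages_first_record; rewrite ?walk0//.
  by rewrite ln andbT lt0n; apply: contraTneq el => ->; rewrite walk0 ltxx.
by move=> i j; rewrite !walk_shift lerD2r.
Qed.

Lemma first_record0 : first_record 0 = set0.
Proof. by apply/seteqP; split => // e []; rewrite walk0 ltxx. Qed.

Lemma first_recordS l : first_record l.+1 = no_record l `\` no_record l.+1.
Proof.
apply/seteqP; split => e /=.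
  by move=> [el ei]; split => [//|/(_ l.+1)]; rewrite ltnSn /= leNgt el => /(_ isT).
move=> [el nel]; split => //; rewrite ltNge; apply/negP => el0; apply: nel => i il.
have [->//|il'] := eqVneq i l.+1; apply: el; lia.
Qed.

Lemma no_record_sub m n : (m <= n)%N -> no_record n `<=` no_record m.
Proof. by move=> mn e en i im; apply: en; lia. Qed.

Lemma first_recordT n : no_record n `|` \bigcup_(l in `I_n.+1) first_record l = setT.
Proof.
elim: n => [|n ih].
  by apply/seteqP; split => // e _; left => i; lia.
apply/seteqP; split => // e _.
have : (no_record n `|` \bigcup_(l in `I_n.+1) first_record l) e by rewrite ih.
case=> [en|[l /= ln el]]; last by right; exists l => //=; lia.
have [en1|nen1] := pselect (no_record n.+1 e); first by left.
by right; exists n.+1 => //=; rewrite first_recordS.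
Qed.

Lemma first_record_trivIset : trivIset setT first_record.
Proof.
apply: ltn_trivIset => n m mn; apply/seteqP; split => // e [[em _] [_ en]].
have [m0|m0] := eqVneq m 0%N; first by move: em; rewrite m0 walk0 ltxx.
by move: em; rewrite ltNge en// lt0n m0.
Qed.

Lemma no_record_first l n : (l <= n)%N -> no_record n `&` first_record l = set0.
Proof.
move=> ln; apply/seteqP; split => // e [en [el _]].
move: el; case: l ln => [|l] ln; first by rewrite walk0 ltxx.
by rewrite ltNge en.
Qed.

End record_paths.

Lemma mutually_independent_comp d (T : measurableType d) (R : realType)
    (P : probability T R) (X Y : nat -> {RV P >-> R}) (s t : nat -> nat)
    (g : nat -> R -> R) :
  mutually_independent X -> cancel s t ->
  (forall i, measurable_fun setT (g i)) ->
  (forall i w, Y i w = g i (X (s i) w)) -> mutually_independent Y.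
Proof.
move=> iX st mg Yg J A mA.
have mgA i : measurable (g i @^-1` A i) by rewrite -[X in measurable X]setTI; exact: mg.
have YX i : Y i @^-1` A i = X (s i) @^-1` (g i @^-1` A i).
  by apply/seteqP; split => w /=; rewrite Yg.
have := iX [fset s i | i in J]%fset (fun k => g (t k) @^-1` A (t k)) (fun k => mgA (t k)).
rewrite big_imfset/=; last by move=> i j _ _; exact: (can_inj st).
have -> : \bigcap_(i in [set` [fset s i | i in J]%fset]) X i @^-1` (g (t i) @^-1` A (t i)) =
    \bigcap_(i in [set` J]) Y i @^-1` A i.
  apply/seteqP; split => w /= wA i /=.
    move=> iJ; have := wA (s i); rewrite /= st Yg; apply.
    exact: in_imfset.
  by move=> /imfsetP[j /= jJ ->]; rewrite st -Yg; exact: wA.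
by move=> ->; apply: eq_bigr => i _; rewrite YX st.
Qed.

Section walk_measurable.
Context {R : realType}.
Implicit Types D : set nat.

Lemma measurable_walk D n i : `I_n `<=` D -> (i <= n)%N ->
  measurable_fun setT (fun e : @g_sigma_algebraType (nat -> R) (cylinder D) => walk e i).
Proof.
move=> nD im; apply: measurable_sum => j; apply: measurable_coordinate.
by apply: nD => /=; exact: leq_trans im.
Qed.

Lemma measurable_no_record D n : `I_n `<=` D ->
  measurable (no_record n : set (@g_sigma_algebraType (nat -> R) (cylinder D))).
Proof.
move=> nD.
have -> : no_record n = \bigcap_(i in [set i | (0 < i <= n)%N])
    ((fun e : nat -> R => walk e i) @^-1` `]-oo, 0]).
  by apply/seteqP; split => e /= h i /= /h; rewrite ?in_itv.
apply: bigcap_measurableType => i /= /andP[_ im]; rewrite -[X in measurable X]setTI.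
by apply: (measurable_walk nD im).
Qed.

Lemma measurable_first_record D l : `I_l `<=` D ->
  measurable (first_record l : set (@g_sigma_algebraType (nat -> R) (cylinder D))).
Proof.
case: l => [|l] lD; first by rewrite first_record0.
rewrite first_recordS; apply: measurableD; apply: measurable_no_record => //.
by move=> i /= il; apply: lD => /=; lia.
Qed.

Lemma measurable_shift_seq l (D1 D2 : set nat) : (forall i, D2 i -> D1 (l + i)%N) ->
  measurable_fun setT (shift_seq l : @g_sigma_algebraType (nat -> R) (cylinder D1) ->
    @g_sigma_algebraType (nat -> R) (cylinder D2)).
Proof.
move=> D21; apply: measurable_path => i /D21 D1i.
exact: (measurable_coordinate D1i).
Qed.

(** Splitting by the time of the first record, written as a sum of products: each factor of a term
    depends on its own block of jumps. The empty case [l = 0] keeps the indices of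
    [renewal_mean_first]. *)
Lemma ages_indicator (G : seq nat -> R) n (e : nat -> R) : G (ages (walk e) n) =
  \1_(no_record n) e * G [:: n] + \sum_(l < n.+1) \1_(first_record l) e *
    G ((l : nat) :: ages (walk (shift_seq l e)) (n - l)).
Proof.
have [en|nen] := pselect (no_record n e).
  rewrite walk_ages_no_record// indicE mem_set// mul1r big1 ?addr0// => l _.
  rewrite indicE memNset ?mul0r// => el.
  have : (no_record n `&` first_record l) e by [].
  by rewrite no_record_first// -ltnS.
have : (no_record n `|` \bigcup_(l in `I_n.+1) first_record l) e.
  by rewrite first_recordT.
case=> // -[l /= ln el]; rewrite indicE memNset// mul0r add0r.
rewrite (bigD1 (Ordinal ln))//= big1 ?addr0.
  by rewrite indicE mem_set// mul1r -walk_ages_first_record.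
move=> j jl; rewrite indicE memNset ?mul0r// => ej.
move/eqP: jl; apply; apply: val_inj => /=.
by apply: (@first_record_trivIset R) => //; exists e.
Qed.

Lemma measurable_ages (G : seq nat -> R) n : measurable_fun setT
  (fun e : @g_sigma_algebraType (nat -> R) (cylinder setT) => G (ages (walk e) n)).
Proof.
elim/ltn_ind: n G => n ih G.
apply: (eq_measurable_fun (fun e : @g_sigma_algebraType (nat -> R) (cylinder setT) => \1_(no_record n) e * G [:: n] +
  \sum_(l < n.+1) \1_(first_record l) e *
    G ((l : nat) :: ages (walk (shift_seq l e)) (n - l)))).
  by move=> e _; rewrite -ages_indicator.
apply: measurable_funD.
  by apply: measurable_funM => //; apply: measurable_indic; exact: measurable_no_record.
apply: measurable_sum => l; have [l0|l0] := posnP l.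
  rewrite [X in measurable_fun _ X](_ : _ = cst 0)//; apply/funext => e.
  by rewrite l0 first_record0 indic0 mul0r.
apply: measurable_funM.
  by apply: measurable_indic; exact: measurable_first_record.
apply: (measurableT_comp (ih (n - l)%N _ (fun c => G ((l : nat) :: c)))).
  by have := ltn_ord l; lia.
exact: measurable_shift_seq.
Qed.

End walk_measurable.

(** An atom at [c] is a jump of the distribution function: its mass separates the value at [c] from
    every value to the left, here at [c - r / 2]. *)
Lemma continuous_law_no_atom d (T : measurableType d) (R : realType)
    (P : probability T R) (Y : {RV P >-> R}) (c : R) :
  continuous_law Y -> P (Y @^-1` [set c]) = 0%E.
Proof.
move=> cY; have mpre (A : set R) : measurable A -> measurable (Y @^-1` A).
  by move=> mA; rewrite -[X in measurable X]setTI; exact: measurable_funP.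
have Pfin (A : set R) : measurable A -> P (Y @^-1` A) \is a fin_num.
  by move=> mA; apply: fin_num_measure; exact: (mpre A mA).
have mc : measurable [set c] by exact: measurable_set1.
have [//|p0] := eqVneq (P (Y @^-1` [set c])) 0%E; exfalso.
have {}p0 : (0 < fine (P (Y @^-1` [set c])))%R.
  by rewrite fine_gt0// lt0e p0 measure_ge0 ltey_eq Pfin.
have /fine_cvg : cdf Y x @[x --> c] --> (fine (cdf Y c))%:E.
  by rewrite fineK; [exact: cY|exact: Pfin].
move=> /cvgrPdist_lt/(_ _ p0)/nbhs_ballP[r /= r0 /(_ (c - r / 2))].
rewrite /ball /= opprB addrC subrK gtr0_norm ?divr_gt0// ltr_pdivrMr// ltr_pMr// ltr1n.
move=> /(_ isT); rewrite ltNge => /negP; apply.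
apply: le_trans (ler_norm _); rewrite lerBrDl -lee_fin EFinD !fineK ?Pfin//.
rewrite -measureU ?mpre//; last first.
  apply/seteqP; split => // w [/= + wc]; rewrite in_itv/= wc.
  by apply/negP; rewrite -ltNge ltrBlDr ltrDl divr_gt0.
apply: le_measure; rewrite ?inE//; first exact: measurableU.
move=> x [|->] /=; rewrite !in_itv//= => /le_trans; apply.
by rewrite gerBl divr_ge0// ltW.
Qed.

(** * Fluctuation identities for the symmetric walk *)

Section symmetric_walk.
Context d (T : measurableType d) (R : realType) (P : probability T R)
  (eta : nat -> {RV P >-> R}).
Hypothesis eta_indep : mutually_independent eta.
Hypothesis eta_id : identically_distributed eta.
Hypothesis eta_sym : forall i, symmetric_law (eta i).
Hypothesis eta_cont : forall i, continuous_law (eta i).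

Local Notation seqs D := (@g_sigma_algebraType (nat -> R) (cylinder D)).

Let path := path_of eta.

Lemma measurable_path_event D (E : set (nat -> R)) :
  measurable (E : set (seqs D)) -> measurable (path @^-1` E).
Proof. exact: measurable_path_preimage. Qed.

Lemma shift_indep l : mutually_independent (fun i => eta (l + i)%N).
Proof.
apply: (@mutually_independent_comp _ _ _ _ eta _ (addn l) (subn^~ l) (fun=> id)) => //.
exact: addKn.
Qed.

Lemma shift_law l E : measurable (E : set (seqs setT)) ->
  P ((shift_seq l \o path) @^-1` E) = P (path @^-1` E).
Proof.
move=> mE; have := independent_law_unique (shift_indep l) eta_indep _ mE; apply.
by move=> i A mA; exact: eta_id.
Qed.

Lemma measurable_shift_event l E : measurable (E : set (seqs setT)) ->
  measurable (path @^-1` (shift_seq l @^-1` E)).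
Proof.
move=> mE; apply: (@measurable_path_event setT).
rewrite -[X in measurable X]setTI.
exact: (@measurable_shift_seq R l setT setT (fun _ _ => I) measurableT E mE).
Qed.

Lemma shift_integral l (f : seqs setT -> \bar R) :
  measurable_fun setT f -> (forall e, 0 <= f e)%E ->
  (\int[P]_w f (shift_seq l (path w)) = \int[P]_w f (path w))%E.
Proof.
move=> mf f0.
pose Z (X : nat -> {RV P >-> R}) : {mfun T >-> seqs setT} := HB.pack (path_of X)
  (isMeasurableFun.Build _ _ _ _ _ (@measurable_path_of _ _ _ _ X setT)).
have := @ge0_integral_distribution _ _ _ _ _ P (Z eta) f mf f0.
have := @ge0_integral_distribution _ _ _ _ _ P (Z (fun i => eta (l + i)%N)) f mf f0.
move=> <- <-; apply: eq_measure_integral => E mE _.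
exact: shift_law.
Qed.

Lemma independent_shift l E1 E2 :
  measurable (E1 : set (seqs `I_l)) ->
  measurable (E2 : set (seqs setT)) ->
  P (path @^-1` (E1 `&` shift_seq l @^-1` E2)) = (P (path @^-1` E1) * P (path @^-1` E2))%E.
Proof.
move=> mE1 mE2; rewrite -(shift_law l mE2).
apply: (@independent_events _ _ _ _ eta `I_l [set i | l <= i]%N E1 (shift_seq l @^-1` E2)) => //.
  by apply/seteqP; split => // i [/= il li]; lia.
rewrite -[X in measurable X]setTI; apply: (@measurable_shift_seq _ l) => //.
by move=> i _ /=; exact: leq_addr.
Qed.

Lemma walk1S e i : walk e i.+1 = e 0%N + walk (shift_seq 1 e) i :> R.
Proof. by rewrite walk_shift add1n [walk e 1]/walk big_ord1 addrC subrK. Qed.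

(** With the later jumps fixed, the first jump would have to take one prescribed value, which has
    probability 0. *)
Lemma walk_eq0 i : P (path @^-1` [set e | walk e i.+1 = 0]) = 0%E.
Proof.
pose D1 := [set j | 1 <= j]%N; pose D2 := [set 0%N].
pose S1 := seqs D1.
pose S2 := seqs D2.
have mw : measurable_fun setT (fun e : seqs setT => walk e i).
  exact: (@measurable_walk R setT i i).
have msh : measurable_fun setT (shift_seq 1 : S1 -> seqs setT).
  exact: measurable_shift_seq.
have ms : measurable_fun setT (fun z : (S1 * S2)%type => z.2 0%N + walk (shift_seq 1 z.1) i).
  apply: measurable_funD.
    by apply: (measurableT_comp (@measurable_coordinate R D2 0%N _)).
  by apply: (measurableT_comp mw (measurableT_comp msh _)).
pose f (z : (S1 * S2)%type) : \bar R := (\1_[set 0] (z.2 0%N + walk (shift_seq 1 z.1) i))%:E.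
have mf : measurable_fun setT f.
  apply/measurable_EFinP.
  by apply: (measurableT_comp (measurable_indic (measurable_set1 0)) ms).
have -> : P (path @^-1` [set e | walk e i.+1 = 0]) = (\int[P]_w f (path w, path w))%E.
  have mE : measurable (path @^-1` [set e | walk e i.+1 = 0]).
    apply: (@measurable_path_event setT); rewrite -[X in measurable X]setTI.
    by apply: (@measurable_walk R setT i.+1 i.+1 _ _ measurableT [set 0]).
  rewrite -[path @^-1` _]setIT -integral_indic//; apply: eq_integral => w _.
  rewrite /f !indicE; congr (_%:R%:E); congr nat_of_bool.
  by apply/idP/idP; rewrite !inE /= walk1S.
rewrite (independent_block_integral eta_indep _ mf)//; last 2 first.
- by apply/seteqP; split => // j [/= + j0]; rewrite j0.
- by move=> z; rewrite lee_fin.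
apply: integral0_eq => w _.
rewrite -[RHS](continuous_law_no_atom (- walk (shift_seq 1 (path w)) i) (@eta_cont 0)).
have me : measurable (eta 0%N @^-1` [set - walk (shift_seq 1 (path w)) i]).
  by rewrite -[X in measurable X]setTI; exact: measurable_funP.
rewrite -[eta 0%N @^-1` _]setIT -integral_indic//; apply: eq_integral => w' _.
rewrite /f !indicE; congr (_%:R%:E); congr nat_of_bool.
apply/idP/idP; rewrite !inE /= => h; last by rewrite /path /path_of h addNr.
by apply/eqP; rewrite -addr_eq0; exact/eqP.
Qed.

Definition neg_walk n : set (nat -> R) :=
  [set e | forall i, (0 < i <= n)%N -> walk e i < 0].

Lemma measurable_neg_walk D n : `I_n `<=` D -> measurable (neg_walk n : set (seqs D)).
Proof.
move=> nD.
have -> : neg_walk n = \bigcap_(i in [set i | (0 < i <= n)%N])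
    ((fun e : nat -> R => walk e i) @^-1` `]-oo, 0[).
  by apply/seteqP; split => e /= h i /= /h; rewrite ?in_itv.
apply: bigcap_measurableType => i /= /andP[_ im]; rewrite -[X in measurable X]setTI.
by apply: (measurable_walk nD im).
Qed.

(** Reversal turns a strict maximum into a strictly negative walk, whereas the absence of records is
    a weak inequality. Ties with the level 0 form a null set, which reconciles the two. *)
Lemma neg_walk_prob n : P (path @^-1` neg_walk n) = P (path @^-1` no_record n).
Proof.
have mnr := @measurable_path_event setT _ (@measurable_no_record R setT n (fun _ _ => I)).
have mnw := @measurable_path_event setT _ (@measurable_neg_walk setT n (fun _ _ => I)).
pose Z := \bigcup_i (path @^-1` [set e | walk e i.+1 = 0]).
have mZi i : measurable (path @^-1` [set e | walk e i.+1 = 0]).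
  apply: (@measurable_path_event setT); rewrite -[X in measurable X]setTI.
  by apply: (@measurable_walk R setT i.+1 i.+1 _ _ measurableT [set 0]).
have mZ : measurable Z by exact: bigcup_measurable.
have Z0 : P Z = 0%E.
  apply/eqP; rewrite -measure_le0 (le_trans (measure_sigma_subadditive P mZi mZ _))//.
  by rewrite eseries0// => i _ _; exact: walk_eq0.
have -> : path @^-1` no_record n = path @^-1` neg_walk n `|` (path @^-1` no_record n `&` Z).
  apply/seteqP; split => w /= => [wn|[wn|[]//]]; last by move=> i /wn/ltW.
  have [wZ|nwZ] := pselect (Z w); [by right|left => i i0].
  rewrite lt_neqAle wn// andbT; apply/eqP => wi; apply: nwZ; exists i.-1 => //=.
  by rewrite prednK//; case/andP: i0.
rewrite measureU0//; first exact: measurableI.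
apply/eqP; rewrite -measure_le0 -Z0 le_measure ?inE//; exact: measurableI.
Qed.

(** Strict before [j] and weak after it: with this convention the events partition the whole space
    even in the presence of ties. *)
Definition first_max j n : set (nat -> R) :=
  [set e | forall i, (i < j)%N -> walk e i < walk e j] `&` shift_seq j @^-1` no_record (n - j).

Lemma first_maxT n : \bigcup_(j in `I_n.+1) first_max j n = setT.
Proof.
apply/seteqP; split => // e _.
have ex : exists j, (j <= n)%N && [forall i : 'I_n.+1, walk e i <= walk e j].
  have [j _ jmax] := @arg_maxP _ _ 'I_n.+1 ord0 xpredT (fun i => walk e i) isT.
  by exists j; rewrite -ltnS ltn_ord /=; apply/forallP => i; exact: jmax.
case: (ex_minnP ex) => {ex}j /andP[jn /forallP jmax] jmin.
exists j => //=; split => [i ij /=|i /andP[i0 ij]].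
  rewrite ltNge; apply/negP => ji; have := jmin i; rewrite [(j <= i)%N]leqNgt ij => /contraFF/(_ erefl).
  rewrite (leq_trans (ltnW ij) jn) /= => /forallP; apply => k.
  exact: le_trans (jmax k) ji.
have lt_n : (j + i < n.+1)%N by lia.
by rewrite walk_shift subr_le0; exact: jmax (Ordinal lt_n).
Qed.

Lemma first_max_trivIset n : trivIset `I_n.+1 (first_max^~ n).
Proof.
have disj i j e : (i < j <= n)%N -> first_max i n e -> first_max j n e -> False.
  move=> /andP[ij jn] [_ ei] [ej _].
  have ok : (0 < j - i <= n - i)%N by lia.
  by have := ei _ ok; rewrite walk_shift subnKC ?(ltnW ij)// subr_le0 leNgt ej.
move=> i j ni nj [e [ei ej]].
case: (ltngtP i j) => // ij; exfalso.
  by apply: (disj i j e _ ei ej); rewrite ij.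
by apply: (disj j i e _ ej ei); rewrite ij.
Qed.

(** Independence concerns whole sequences, so the reversal is extended by the identity on indices
    from [j] on; the resulting index map is its own inverse. *)
Let rev_indep j (Y : nat -> {RV P >-> R}) :
  (forall i w, Y i w = - eta (if (i < j)%N then (j - i.+1)%N else i) w) ->
  mutually_independent Y.
Proof.
pose s i := if (i < j)%N then (j - i.+1)%N else i.
move=> YE; apply: (@mutually_independent_comp _ _ _ _ eta Y s s (fun=> -%R)) => //.
by move=> i; rewrite /s; case: (ltnP i j) => ij; [rewrite ifT; lia|rewrite ltnNge ij].
Qed.

(* Reverse the order of the first [j] jumps and change their sign. *)
Lemma strict_max_prob j :
  P (path @^-1` [set e | forall i, (i < j)%N -> walk e i < walk e j]) =
  P (path @^-1` no_record j).
Proof.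
have mY i : measurable_fun setT (fun w => - eta (if (i < j)%N then (j - i.+1)%N else i) w).
  exact: measurableT_comp.
pose Y i : {RV P >-> R} := HB.pack (fun w => - eta (if (i < j)%N then (j - i.+1)%N else i) w)
  (isMeasurableFun.Build _ _ _ _ _ (mY i)).
rewrite -neg_walk_prob.
have mnw : measurable (neg_walk j : set (seqs setT)) by exact: measurable_neg_walk.
have <- := @independent_law_unique _ _ _ _ _ _ _ Y eta setT (@rev_indep j Y (fun _ _ => erefl))
  eta_indep _ _ mnw.
  congr (P _); apply/seteqP.
  have walkY w i : (i <= j)%N -> walk (path_of Y w) i = walk (path w) (j - i) - walk (path w) j.
    elim: i => [|i ih] ij; first by rewrite walk0 subn0 subrr.
    rewrite /walk big_ord_recr /= -/(walk _ _) ih ?(ltnW ij)// /path_of /= ij.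
    have -> : (j - i = (j - i.+1).+1)%N by lia.
    by rewrite /walk big_ord_recr /= /path /path_of addrAC addrK.
  split => w /= h i.
    by move=> /andP[i0 ij]; rewrite walkY// subr_lt0; apply: h; lia.
  move=> ij; rewrite -subr_lt0 -[i in walk _ i](subKn (ltnW ij)) -walkY ?leq_subr//.
  by apply: h; rewrite subn_gt0 ij leq_subr.
move=> i A mA; rewrite (_ : Y i @^-1` A = [set w | A (- eta (if (i < j)%N then (j - i.+1)%N else i) w)])//.
by rewrite -(eta_sym _ mA); exact: eta_id.
Qed.

Lemma no_record_prob n : P (path @^-1` no_record n) = (neg_binom (1 / 2) n)%:E.
Proof.
have mnr D m : `I_m `<=` D -> measurable (no_record m : set (seqs D)).
  exact: measurable_no_record.
have mP m := @measurable_path_event setT _ (mnr setT m (fun _ _ => I)).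
rewrite -(fineK (fin_num_measure P _ (mP n))); congr EFin.
apply: (@sqrt_convolution_unique R (fun n => fine (P (path @^-1` no_record n)))) => [|{}n].
  rewrite (_ : path @^-1` _ = setT) ?probability_setT//.
  by apply/seteqP; split => // w _ i; lia.
apply: EFin_inj; rewrite -sumEFin -(probability_setT P).
have mm j : measurable ([set e | forall i, (i < j)%N -> walk e i < walk e j] : set (seqs `I_j)).
  rewrite (_ : mkset _ = \bigcap_(i in `I_j)
      ((fun e : nat -> R => walk e i - walk e j) @^-1` `]-oo, 0[)); last first.
    have E (x y : R) : `]-oo, 0[%classic (x - y) <-> x < y.
      by rewrite /= in_itv/= subr_lt0.
    by apply/seteqP; split => e h i ij; apply/E; exact: h i ij.
  apply: bigcap_measurableType => i /= ij; rewrite -[X in measurable X]setTI.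
  apply: (@measurable_funB _ (seqs `I_j) R setT (fun e => walk e i) (fun e => walk e j)) => //.
    exact: (@measurable_walk R `I_j j i _ (ltnW ij)).
  exact: (@measurable_walk R `I_j j j).
have -> : setT = \big[setU/set0]_(j < n.+1) (path @^-1` first_max j n).
  rewrite -(bigcup_mkord n.+1 (fun j => path @^-1` first_max j n)) -preimage_bigcup.
  by rewrite first_maxT preimage_setT.
rewrite measure_bigsetU_ord_cond//=.
- apply: eq_bigr => j _; rewrite EFinM !fineK ?fin_num_measure//.
  by rewrite independent_shift// ?strict_max_prob//; exact: mnr.
- move=> j _; rewrite preimage_setI; apply: measurableI.
    exact: measurable_path_event (mm j).
  by apply: measurable_shift_event; exact: mnr.
- move=> i j _ _ [w [wi wj]]; apply: val_inj.
  apply: (@first_max_trivIset n) => //=; try exact: ltn_ord.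
  by exists (path w).
Qed.

Lemma first_record_prob l : P (path @^-1` first_record l) = (record_gap l)%:E.
Proof.
case: l => [|l]; first by rewrite first_record0 preimage_set0 measure0.
have mnr m : measurable (path @^-1` no_record m).
  by apply: (@measurable_path_event setT); exact: measurable_no_record.
have -> : path @^-1` first_record l.+1 = path @^-1` no_record l `\` path @^-1` no_record l.+1.
  by rewrite first_recordS.
rewrite measureD//; last by rewrite ltey_eq fin_num_measure.
rewrite setIidr; last by move=> w; apply: no_record_sub.
by rewrite [record_gap _]/= EFinB -!no_record_prob.
Qed.

(** Given a first record at [l], the later jumps form a fresh walk with horizon [n - l]. Hence the
    expectation obeys the recursion [renewal_mean_first]. *)
Lemma ages_mean n (G : seq nat -> R) : (forall c, 0 <= G c) ->
  (\int[P]_w (G (ages (walk (path w)) n))%:E = (renewal_mean n G)%:E)%E.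
Proof.
elim/ltn_ind: n G => n ih G G0.
have mages m H : measurable_fun setT (fun w => H (ages (walk (path w)) m) : R).
  by apply: (measurableT_comp (@measurable_ages R H m)); exact: measurable_path_of.
have mind (E : set (nat -> R)) : measurable (E : set (seqs setT)) ->
    measurable_fun setT (fun w => \1_E (path w) : R).
  by move=> mE; apply: (measurableT_comp (measurable_indic mE)); exact: measurable_path_of.
have ind_prob E : measurable (E : set (seqs setT)) ->
    (\int[P]_w (\1_E (path w))%:E = P (path @^-1` E))%E.
  by move=> mE; rewrite -[X in P X]setIT -integral_indic//; exact: measurable_path_event mE.
have mshift l H : measurable_fun setT
    (fun w => H (ages (walk (shift_seq l (path w))) (n - l)%N) : R).
  apply: (measurableT_comp (@measurable_ages R H (n - l)%N)).
  apply: (measurableT_comp (@measurable_shift_seq R l setT setT (fun _ _ => I))).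
  exact: measurable_path_of.
under eq_integral do rewrite ages_indicator EFinD -sumEFin.
rewrite ge0_integralD//=; last 4 first.
- by move=> w _; rewrite lee_fin mulr_ge0.
- apply/measurable_EFinP; apply: measurable_funM => //.
  by apply: mind; exact: measurable_no_record.
- by move=> w _; apply: sume_ge0 => l _; rewrite lee_fin mulr_ge0.
- apply: emeasurable_sum => l; apply/measurable_EFinP; apply: measurable_funM => //.
    by apply: mind; exact: measurable_first_record.
  exact: (mshift l (fun c => G ((l : nat) :: c))).
rewrite renewal_mean_first EFinD; congr (_ + _)%E.
  under eq_integral do rewrite EFinM.
  rewrite ge0_integralZr ?lee_fin//; last first.
    by apply/measurable_EFinP/mind; exact: measurable_no_record.
  by rewrite ind_prob ?no_record_prob//; exact: measurable_no_record.
rewrite ge0_integral_sum//=; last 2 first.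
- move=> l; apply/measurable_EFinP; apply: measurable_funM => //.
    by apply: mind; exact: measurable_first_record.
  exact: (mshift l (fun c => G ((l : nat) :: c))).
- by move=> l w _; rewrite lee_fin mulr_ge0.
rewrite -sumEFin; apply: eq_bigr => l _; have [l0|l0] := posnP l.
  by rewrite l0 first_record0 /= mul0r; apply: integral0_eq => w _; rewrite indic0 mul0r.
under eq_integral do rewrite EFinM.
pose D2 := [set i | l <= i]%N; pose H c := G ((l : nat) :: c).
rewrite (@independent_integralM _ _ _ P eta eta_indep `I_l D2
  (fun e => (\1_(first_record l) e)%:E)
  (fun e => (H (ages (walk (shift_seq l e)) (n - l)%N))%:E))//; last 4 first.
- by apply/seteqP; split => // i [/= il li]; move: il; rewrite ltnNge li.
- by apply/measurable_EFinP; apply: measurable_indic; exact: measurable_first_record.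
- apply/measurable_EFinP; apply: (measurableT_comp (@measurable_ages R H (n - l)%N)).
  by apply: (@measurable_shift_seq R l D2 setT) => i _ /=; exact: leq_addr.
- by move=> e; rewrite lee_fin /H.
rewrite EFinM ind_prob ?first_record_prob//; last exact: measurable_first_record.
congr (_ * _)%E; rewrite -(ih (n - l)%N)//; last by have := ltn_ord l; lia.
rewrite (@shift_integral l (fun e => (H (ages (walk e) (n - l)%N))%:E))//.
- by apply/measurable_EFinP; exact: measurable_ages.
- by move=> e; rewrite lee_fin /H.
Qed.

End symmetric_walk.

(** * Moments of the beta law *)

Section density.
Local Open Scope ereal_scope.
Context d (T : measurableType d) (R : realType).
Variables (mu nu : {measure set T -> \bar R}) (rho : T -> R).
Hypotheses (mrho : measurable_fun setT rho) (rho0 : forall x, (0 <= rho x)%R).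
Hypothesis nuE : forall A, measurable A -> nu A = \int[mu]_(x in A) (rho x)%:E.

Import HBNNSimple.

Let mErho : measurable_fun setT (EFin \o rho).
Proof. exact/measurable_EFinP. Qed.

Let Erho0 x : 0 <= (rho x)%:E.
Proof. by rewrite lee_fin. Qed.

Let nnsfun_density (f : {nnsfun T >-> R}) :
  \int[nu]_x (f x)%:E = \int[mu]_x ((f x)%:E * (rho x)%:E).
Proof.
under eq_integral do rewrite fimfunE -fsumEFin//.
rewrite ge0_integral_fsum//; last 2 first.
  - by move=> r; exact/measurable_EFinP/measurable_funM.
  - by move=> r x _; rewrite EFinM nnfun_muleindic_ge0.
under [RHS]eq_integral => x _.
  rewrite fimfunE -fsumEFin// fsbig_finite//= ge0_sume_distrl; last first.
    by move=> r _; rewrite EFinM nnfun_muleindic_ge0.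
  rewrite -fsbig_finite//=; over.
rewrite /= ge0_integral_fsum//; last 2 first.
  - move=> r; apply: emeasurable_funM => //.
    by apply/measurable_EFinP; exact: measurable_funM.
  - by move=> r x _; rewrite mule_ge0// EFinM nnfun_muleindic_ge0.
apply: eq_fsbigr => r _; rewrite integralZl_indic_nnsfun// integral_indic// setIT nuE//.
under [RHS]eq_integral do rewrite EFinM -muleA.
have [r0|r0] := leP 0%R r.
  rewrite ge0_integralZl//; last 2 first.
  - by apply: emeasurable_funM => //; exact/measurable_EFinP.
  - by move=> x _; rewrite mule_ge0// lee_fin.
  congr (_ * _); rewrite integral_mkcond; apply: eq_integral => x _.
  by rewrite patchE indicE; case: ifPn; rewrite ?mul1e ?mul0e.
rewrite preimage_nnfun0// integral_set0 mule0; apply/esym/integral0_eq => x _.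
by rewrite indic0 mul0e mule0.
Qed.

Lemma ge0_integral_density (f : T -> \bar R) :
  measurable_fun setT f -> (forall x, 0 <= f x) ->
  \int[nu]_x f x = \int[mu]_x (f x * (rho x)%:E).
Proof.
move=> mf f0; pose f_ := nnsfun_approx measurableT mf.
have fE x : limn (fun n => (f_ n x)%:E) = f x.
  by apply/cvg_lim => //; apply: cvg_nnsfun_approx.
transitivity (limn (fun n => \int[nu]_x (f_ n x)%:E)).
  rewrite -monotone_convergence//.
  - by apply: eq_integral => x _; rewrite fE.
  - by move=> n; exact/measurable_EFinP/measurable_funP.
  - by move=> n x _; rewrite lee_fin.
  - by move=> x _ m n mn; rewrite lee_fin; exact/lefP/nd_nnsfun_approx.
transitivity (limn (fun n => \int[mu]_x ((f_ n x)%:E * (rho x)%:E))).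
  by congr (limn _); apply/funext => n; exact: nnsfun_density.
have nd x : {homo (fun n => (f_ n x)%:E * (rho x)%:E) : m n / (m <= n)%N >-> m <= n}.
  by move=> m n mn; rewrite lee_wpmul2r// lee_fin; exact/lefP/nd_nnsfun_approx.
rewrite -monotone_convergence//.
- apply: eq_integral => x _; apply/cvg_lim => //.
  by apply: cvgeZr => //; apply: cvg_nnsfun_approx.
- by move=> n; apply: emeasurable_funM => //; exact/measurable_EFinP/measurable_funP.
- by move=> n x _; rewrite mule_ge0// lee_fin.
Qed.

End density.

(** * Integration by parts for beta integrals *)

Section beta_integrals.
Context {R : realType}.
Implicit Types x y t : R.
Local Notation mu := (@lebesgue_measure R).

Definition beta_fun x y t : R := t `^ x * (1 - t) `^ y.

Lemma beta_fun_ge0 x y t : 0 <= beta_fun x y t.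
Proof. by rewrite mulr_ge0// powR_ge0. Qed.

Lemma measurable_beta_fun x y : measurable_fun setT (beta_fun x y).
Proof.
apply: measurable_funM; first exact: measurable_powR.
have m1 : measurable_fun setT (fun t : R => 1 - t) by exact: measurable_funB.
by have := measurableT_comp (measurable_powR y) m1.
Qed.

Lemma is_derive_beta_fun x y t : 0 < t < 1 ->
  is_derive t 1 (beta_fun x y) (x * beta_fun (x - 1) y t - y * beta_fun x (y - 1) t).
Proof.
move=> /andP[t0 t1].
have d1 : is_derive t 1 (fun a : R => a `^ x) (x * t `^ (x - 1)) by exact: is_derive1_powR.
have d2 : is_derive (1 - t) 1 (fun a : R => a `^ y) (y * (1 - t) `^ (y - 1)).
  by apply: is_derive1_powR; rewrite subr_gt0.
have d3 : is_derive t 1 (fun t : R => 1 - t) (-1).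
  have -> : -1 = 0 - 1 :> R by rewrite sub0r.
  exact: is_deriveB.
have d4 := @is_derive1_comp _ (fun a : R => a `^ y) (fun t : R => 1 - t) t _ _ d2 d3.
have -> : beta_fun x y =
  (fun a : R => a `^ x) * ((fun a : R => a `^ y) \o (fun t : R => 1 - t)) by [].
apply: (is_derive_eq (is_deriveM d1 d4)).
by rewrite /beta_fun /GRing.scale /=; ring.
Qed.

Lemma continuous_beta_fun x y t : 0 < t < 1 -> {for t, continuous (beta_fun x y)}.
Proof.
move=> t01; apply/differentiable_continuous; rewrite -derivable1_diffP.
by have [] := is_derive_beta_fun x y t01.
Qed.

(** The integrands may blow up at 0 and 1, so integrals are taken between [near_ends n] and
    [1 - near_ends n]. The factor 1/3 makes this interval nondegenerate already for [n = 0]. *)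
Let near_ends (n : nat) : R := n.+1%:R^-1 / 3.

Let near_ends_gt0 n : 0 < near_ends n.
Proof. by rewrite divr_gt0// invr_gt0. Qed.

Let near_ends_lt n : near_ends n < 1 - near_ends n.
Proof.
have : n.+1%:R^-1 <= 1 :> R by rewrite invf_le1// ler1n.
by rewrite /near_ends; move: (n.+1%:R^-1) => u u1; lra.
Qed.

Let near_ends_cvg : near_ends @ \oo --> (0 : R).
Proof. by rewrite -[0](mul0r 3^-1); apply: cvgMl; exact: cvg_harmonic. Qed.

Let beta_fun_end x y : 0 < x -> 0 < y -> beta_fun x y (near_ends n) @[n --> \oo] --> (0 : R).
Proof.
move=> x0 y0; apply: (@squeeze_cvgr _ _ _ _ (cst 0) (fun n => near_ends n `^ x)).
- near=> n; rewrite beta_fun_ge0/= ler_piMr ?powR_ge0//.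
  have y1 : 1 `^ y = 1 :> R by rewrite powR1.
  rewrite -[leRHS]y1 ge0_ler_powR ?nnegrE ?ltW//.
    by have := near_ends_lt n; have := near_ends_gt0 n; lra.
  by have := near_ends_gt0 n; lra.
- exact: cvg_cst.
- by have /cvg_at_rightP := @powR_cvg0 R x x0; apply.
Unshelve. all: by end_near. Qed.

(** The function [t^x (1-t)^y] vanishes at both ends, so its derivative has integral 0. *)
Lemma beta_by_parts x y : 0 < x -> 0 < y ->
  (x%:E * \int[mu]_(t in `]0%R, 1%R[) (beta_fun (x - 1) y t)%:E =
   y%:E * \int[mu]_(t in `]0%R, 1%R[) (beta_fun x (y - 1) t)%:E)%E.
Proof.
move=> x0 y0.
pose F n : set R := `[near_ends n, 1 - near_ends n]%classic.
have FP n t : F n t <-> near_ends n <= t <= 1 - near_ends n.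
  by rewrite /F /= in_itv.
have F01 : `]0%R, 1%R[%classic = \bigcup_n F n.
  apply/seteqP; split => t /=.
    rewrite in_itv/= => /andP[t0 t1].
    have m0 : 0 < Num.min t (1 - t) by rewrite lt_min t0 subr_gt0.
    have [N _ /(_ N (leqnn _)) /=] := cvgr_lt _ near_ends_cvg _ m0.
    rewrite lt_min => /andP[Nt Nt1]; exists N => //; apply/FP.
    by rewrite (ltW Nt) lerBrDl -lerBrDr ltW.
  move=> [n _ /FP]; rewrite in_itv/=; have := near_ends_gt0 n; lra.
have ndF : nondecreasing_seq F.
  move=> n m nm; rewrite subsetEset => t /FP/andP[nt tn]; apply/FP.
  have : near_ends m <= near_ends n.
    by rewrite ler_pM2r ?invr_gt0// lef_pV2 ?posrE// ler_nat ltnS.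
  lra.
have FE n t : F n t -> 0 < t < 1.
  by move=> /FP; have := near_ends_gt0 n; lra.
have mF n : measurable (F n) by exact: measurable_itv.
have lim_int a b : (\int[mu]_(t in F n) (beta_fun a b t)%:E @[n --> \oo] -->
    \int[mu]_(t in `]0%R, 1%R[) (beta_fun a b t)%:E)%E.
  rewrite F01; apply: ge0_nondecreasing_set_cvg_integral => //.
  - by move=> n; apply/measurable_EFinP/measurable_funTS; exact: measurable_beta_fun.
  - by move=> n t _; rewrite lee_fin beta_fun_ge0.
have cont a b n : {within F n, continuous (beta_fun a b)}.
  apply: continuous_in_subspaceT => t /[!inE] /FE; exact: continuous_beta_fun.
have integr a b n : mu.-integrable (F n) (EFin \o beta_fun a b).
  by apply: continuous_compact_integrable => //; exact: segment_compact.
have parts n : (x%:E * \int[mu]_(t in F n) (beta_fun (x - 1) y t)%:E =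
    y%:E * \int[mu]_(t in F n) (beta_fun x (y - 1) t)%:E +
    (beta_fun x y (1 - near_ends n) - beta_fun x y (near_ends n))%:E)%E.
  have Foo t : t \in `]near_ends n, 1 - near_ends n[ -> 0 < t < 1.
    by rewrite in_itv/=; have := near_ends_gt0 n; lra.
  rewrite EFinB -(@continuous_FTC2 R
    (fun t => x * beta_fun (x - 1) y t - y * beta_fun x (y - 1) t)
    (beta_fun x y) _ _ (near_ends_lt n)).
  - under [X in (_ = _ + X)%E]eq_integral do rewrite EFinB !EFinM.
    rewrite integralB//; try by apply: integrableZl => //; exact: integr.
    rewrite !integralZl//; try exact: integr.
    rewrite [RHS]addeC subeK// fin_numM//; apply: integrable_fin_num => //; exact: integr.
  - apply: continuous_in_subspaceT => t /[!inE] /FE t01.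
    apply: cvgB; apply: cvgM; try exact: cvg_cst; exact: continuous_beta_fun.
  - split => [t /Foo t01| |]; first by have [] := is_derive_beta_fun x y t01.
      apply: cvg_at_right_filter; apply: continuous_beta_fun.
      by have := near_ends_lt n; have := near_ends_gt0 n; lra.
    apply: cvg_at_left_filter; apply: continuous_beta_fun.
    by have := near_ends_lt n; have := near_ends_gt0 n; lra.
  - move=> t /Foo t01; have dt := is_derive_beta_fun x y t01.
    by rewrite derive1E derive_val.
have L := cvgeZl (isT : x%:E \is a fin_num) (lim_int (x - 1) y).
have RR : (y%:E * \int[mu]_(t in F n) (beta_fun x (y - 1) t)%:E +
    (beta_fun x y (1 - near_ends n) - beta_fun x y (near_ends n))%:E @[n --> \oo] -->
    y%:E * \int[mu]_(t in `]0%R, 1%R[) (beta_fun x (y - 1) t)%:E + 0)%E.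
  apply: cvgeD; first by rewrite fin_num_adde_defl.
    exact: cvgeZl.
  apply: cvg_EFin; first by near=> n.
  have end0 : beta_fun x y (1 - near_ends n) @[n --> \oo] --> (0 : R).
    rewrite (_ : (fun _ => _) = (fun n => beta_fun y x (near_ends n))).
      exact: beta_fun_end.
    by apply/funext => n; rewrite /beta_fun subKr mulrC.
  have := cvgB end0 (beta_fun_end x0 y0); rewrite subrr; apply.
move: RR; under eq_fun do rewrite -parts.
by rewrite adde0 => /(cvg_unique _ L)->.
Unshelve. all: by end_near. Qed.

End beta_integrals.

Section beta_moments.
Context d (T : measurableType d) (R : realType) (P : probability T R).
Variables (a b : R) (U : {RV P >-> R}).
Hypotheses (a0 : 0 < a) (b0 : 0 < b) (Ubeta : beta_law a b U).
Local Notation mu := (@lebesgue_measure R).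
Local Notation D := (`]0%R, 1%R[%classic : set R).

Let Z := \int[mu]_(y in `]0, 1[) (y `^ (a - 1) * (1 - y) `^ (b - 1)).

Let density_ge0 x : 0 <= beta_density a b x.
Proof.
rewrite /beta_density divr_ge0 ?beta_fun_ge0//.
by apply: Rintegral_ge0 => // y _; exact: beta_fun_ge0.
Qed.

Let density_measurable : measurable_fun setT (beta_density a b).
Proof. by apply: measurable_funM => //; exact: measurable_beta_fun. Qed.

Let mD : measurable D. Proof. exact: measurable_itv. Qed.

Let I j m : \bar R := (\int[mu]_(t in D) (beta_fun (a + j%:R - 1) (b + m%:R - 1) t)%:E)%E.

Lemma ge0_integral_beta (phi : R -> \bar R) :
  measurable_fun setT phi -> (forall x, 0 <= phi x)%E ->
  (\int[P]_w phi (U w) = \int[mu]_(t in D) (phi t * (beta_density a b t)%:E))%E.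
Proof.
move=> mphi phi0.
(* [lebesgue_measure] lives on [measurableTypeR R], not on [R] itself. *)
have mU : measurable_fun setT (U : T -> measurableTypeR R).
  exact: (@measurable_funP _ _ _ _ setT U).
pose V : {mfun T >-> measurableTypeR R} := HB.pack (U : T -> measurableTypeR R)
  (isMeasurableFun.Build _ _ _ _ _ mU).
have <- := @ge0_integral_distribution _ _ _ _ _ P V phi mphi phi0.
rewrite (@ge0_integral_density _ _ R mu _ ((beta_density a b) \_ D))//.
- rewrite [RHS]integral_mkcond; apply: eq_integral => t _.
  by rewrite !patchE; case: ifPn => // _; rewrite mule0.
- by apply/(measurable_restrictT _ mD); exact: measurable_funTS.
- by move=> x; rewrite patchE; case: ifPn.
- move=> A mA; transitivity (distribution P U A); first by [].
  rewrite Ubeta// integral_mkcondr; apply: eq_integral => t _.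
  by rewrite !patchE; case: ifPn.
Qed.

(** The normalisation is read off from the total mass 1 of the law of [U]; finiteness and positivity
    of the beta integral need no separate argument. *)
Let total : (I 0 0 * (Z^-1)%:E = 1)%E.
Proof.
have := @ge0_integral_beta (cst 1%E) (measurable_cst _) (fun=> lee01).
have -> : (\int[P]_w cst 1 (U w) = 1)%E.
  by rewrite (@integral_cst _ _ _ P _ measurableT 1%E) mul1e; exact: probability_setT.
move=> ->.
rewrite -ge0_integralZr ?lee_fin ?invr_ge0//.
- by apply: eq_integral => t _; rewrite mul1e !addr0.
- by apply/measurable_EFinP/measurable_funTS; exact: measurable_beta_fun.
- by move=> t _; rewrite lee_fin beta_fun_ge0.
- by apply: Rintegral_ge0 => // y _; exact: beta_fun_ge0.
Qed.

(** The absolute values keep the integrand nonnegative off the null event that [U] leaves [0, 1]. *)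
Definition beta_moment j m : \bar R := (\int[P]_w (`|U w| ^+ j * `|1 - U w| ^+ m)%:E)%E.

Let mom_measurable j m : measurable_fun setT (fun t : R => `|t| ^+ j * `|1 - t| ^+ m).
Proof.
have m1 : measurable_fun setT (fun t : R => 1 - t) by exact: measurable_funB.
apply: measurable_funM; apply: measurable_funX; first exact: normr_measurable.
by have := measurableT_comp (@normr_measurable R setT) m1.
Qed.

Lemma beta_momentE j m : beta_moment j m = (I j m * (Z^-1)%:E)%E.
Proof.
rewrite /beta_moment (@ge0_integral_beta (fun t => (`|t| ^+ j * `|1 - t| ^+ m)%:E)).
- rewrite -ge0_integralZr ?lee_fin ?invr_ge0//.
  + apply: eq_integral => t; rewrite inE /= in_itv/= => /andP[t0 t1].
    have t1' : 0 < 1 - t by rewrite subr_gt0.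
    rewrite -!EFinM /beta_density -/Z mulrA; congr (_ / _)%:E.
    rewrite /beta_fun !gtr0_norm// -!powR_mulrn ?(ltW t0) ?(ltW t1')//.
    rewrite mulrACA -!powRD ?(gt_eqF t0) ?(gt_eqF t1') ?implybT//.
    by rewrite !addrA [_ + a]addrC [_ + b]addrC.
  + by apply/measurable_EFinP/measurable_funTS; exact: measurable_beta_fun.
  + by move=> t _; rewrite lee_fin beta_fun_ge0.
  + by apply: Rintegral_ge0 => // y _; exact: beta_fun_ge0.
- exact/measurable_EFinP.
- by move=> x; rewrite lee_fin mulr_ge0// exprn_ge0.
Qed.

Let beta_moment0 : beta_moment 0 0 = 1%E.
Proof. by rewrite beta_momentE total. Qed.

Let Ige0 j m : (0 <= I j m)%E.
Proof. by apply: integral_ge0 => t _; rewrite lee_fin beta_fun_ge0. Qed.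

Let beta_moment_split j m :
  beta_moment j m = (beta_moment j.+1 m + beta_moment j m.+1)%E.
Proof.
rewrite !beta_momentE -ge0_muleDl//; congr (_ * _)%E.
rewrite /I -ge0_integralD//.
- apply: eq_integral => t; rewrite inE /= in_itv/= => /andP[t0 t1].
  have t1' : 0 < 1 - t by rewrite subr_gt0.
  rewrite -EFinD; congr EFin; rewrite /beta_fun.
  have -> : a + j.+1%:R - 1 = a + j%:R by rewrite -[j.+1%:R]natr1; ring.
  have -> : b + m.+1%:R - 1 = b + m%:R by rewrite -[m.+1%:R]natr1; ring.
  rewrite -(@mulr_powRB1 _ t (a + j%:R)) ?ltW// ?ltr_wpDr//.
  rewrite -(@mulr_powRB1 _ (1 - t) (b + m%:R)) ?ltW// ?ltr_wpDr//.
  by move: (_ `^ _) (_ `^ _) => u v; ring.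
- by move=> t _; rewrite lee_fin beta_fun_ge0.
- by apply/measurable_EFinP/measurable_funTS; exact: measurable_beta_fun.
- by move=> t _; rewrite lee_fin beta_fun_ge0.
- by apply/measurable_EFinP/measurable_funTS; exact: measurable_beta_fun.
Qed.

Let beta_moment_parts j m :
  ((a + j%:R)%:E * beta_moment j m.+1 = (b + m%:R)%:E * beta_moment j.+1 m)%E.
Proof.
rewrite !beta_momentE !muleA; apply: (congr1 (fun z => z * (Z^-1)%:E)%E).
have -> : I j m.+1 = (\int[mu]_(t in D) (beta_fun (a + j%:R - 1) (b + m%:R) t)%:E)%E.
  by apply: eq_integral => t _; congr (beta_fun _ _ _)%:E;
    rewrite -[m.+1%:R]natr1; ring.
have aj : 0 < a + j%:R by rewrite ltr_wpDr.
have bm : 0 < b + m%:R by rewrite ltr_wpDr.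
have -> := beta_by_parts aj bm; apply: (congr1 (fun z => (b + m%:R)%:E * z)%E).
by apply: eq_integral => t _; congr (beta_fun _ _ _)%:E;
  rewrite -[j.+1%:R]natr1; ring.
Qed.

Let beta_moment_ge0 j m : (0 <= beta_moment j m)%E.
Proof. by apply: integral_ge0 => w _; rewrite lee_fin mulr_ge0// exprn_ge0. Qed.

Let beta_moment_fin j m : beta_moment j m \is a fin_num.
Proof.
rewrite ge0_fin_numE//; apply: (@le_lt_trans _ _ 1%E); last exact: ltry.
elim: j m => [|j ih] m.
  elim: m => [|m ih]; first by rewrite beta_moment0.
  by apply: le_trans ih; rewrite [leRHS]beta_moment_split leeDr.
by apply: le_trans (ih m); rewrite [leRHS]beta_moment_split leeDl.
Qed.

Let rising (x : R) n : R := n`!%:R * neg_binom x n.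

Let risingS x n : rising x n.+1 = (x + n%:R) * rising x n.
Proof. by rewrite /rising factS natrM mulrAC neg_binomS; ring. Qed.

Let ab0 n : a + b + n%:R != 0.
Proof. by rewrite gt_eqF// ltr_wpDr// addr_gt0. Qed.

(** The splitting [1 = t + (1-t)] and the integration by parts are two linear equations for the
    moments [(j+1, m)] and [(j, m+1)]; solving them expresses both through the moment [(j, m)]. *)
Let beta_moment_rising j m :
  beta_moment j m = (rising a j * rising b m / rising (a + b) (j + m))%:E.
Proof.
pose r j m := fine (beta_moment j m).
have rE i k : beta_moment i k = (r i k)%:E by rewrite fineK.
have r_split i k : r i k = r i.+1 k + r i k.+1.
  by apply: EFin_inj; rewrite EFinD -!rE; exact: beta_moment_split.
have r_parts i k : (a + i%:R) * r i k.+1 = (b + k%:R) * r i.+1 k.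
  by apply: EFin_inj; rewrite !EFinM -!rE; exact: beta_moment_parts.
have rSl i k : r i.+1 k = (a + i%:R) / (a + b + (i + k)%:R) * r i k.
  rewrite [r i k]r_split; apply: (mulfI (ab0 (i + k))).
  rewrite [RHS]mulrA [_ * (_ / _)]mulrC divfK// mulrDr r_parts natrD.
  by move: (r _ _) => u; ring.
have rSr i k : r i k.+1 = (b + k%:R) / (a + b + (i + k)%:R) * r i k.
  rewrite [r i k]r_split; apply: (mulfI (ab0 (i + k))).
  rewrite [RHS]mulrA [_ * (_ / _)]mulrC divfK// mulrDr -r_parts natrD.
  by move: (r _ _) => u; ring.
rewrite rE; congr EFin; have r0 : rising (a + b) 0 = 1 by rewrite /rising neg_binom0 mulr1.
have rne n : rising (a + b) n != 0.
  by rewrite mulf_neq0 ?pnatr_eq0 -?lt0n ?fact_gt0// gt_eqF// neg_binom_gt0// addr_gt0.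
elim: j => [|j ih].
  elim: m => [|m ih].
    by rewrite r0 /rising !neg_binom0 !mulr1 divr1 /r beta_moment0.
  rewrite rSr ih !add0n !risingS; move: (ab0 m) (rne m).
  by move: (a + b + m%:R) (rising (a + b) m) => u v u0 v0; field; rewrite u0 v0.
rewrite rSl ih addSn !risingS; move: (ab0 (j + m)) (rne (j + m)%N).
by move: (a + b + _) (rising (a + b) _) => u v u0 v0; field; rewrite u0 v0.
Qed.

(** The binomial coefficient supplies the factorials that turn the rising factorials of the moments
    into [neg_binom]. *)
Lemma beta_bernstein N j : (j <= N)%N ->
  (\int[P]_w ('C(N, j)%:R * (`|U w| ^+ j * `|1 - U w| ^+ (N - j)))%:E =
   (neg_binom a j * neg_binom b (N - j) / neg_binom (a + b) N)%:E)%E.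
Proof.
move=> jN; under eq_integral do rewrite EFinM.
rewrite ge0_integralZl ?lee_fin//; last first.
  by apply/measurable_EFinP; have := measurableT_comp (mom_measurable j (N - j)) (measurable_funPT U).
rewrite -/(beta_moment j (N - j)) beta_moment_rising subnKC// -EFinM; congr EFin.
have := bin_fact jN => /(congr1 (fun k => k%:R : R)); rewrite !natrM /rising.
have f0 n : n`!%:R != 0 :> R by rewrite pnatr_eq0 -lt0n fact_gt0.
move=> <-; have nb0 : neg_binom (a + b) N != 0 by rewrite gt_eqF// neg_binom_gt0// addr_gt0.
by field; rewrite nb0 !f0 pnatr_eq0 -lt0n bin_gt0.
Qed.

End beta_moments.

(** * Binomial picks *)

Section bernstein.
Context {R : realFieldType}.
Implicit Types (u x t y : R) (phi : nat -> R) (G H : seq nat -> R).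

(* The absolute values make the weight nonnegative for every [u]; they are
   vacuous on [0, 1]. *)
Definition bernstein N u j : R := 'C(N, j)%:R * (`|u| ^+ j * `|1 - u| ^+ (N - j)).

Lemma bernstein_ge0 N u j : 0 <= bernstein N u j.
Proof. by rewrite !mulr_ge0// exprn_ge0. Qed.

(** Conditioning on one trial out of [N + 1], by Pascal's rule. *)
Lemma sum_bernsteinS N u phi : 0 <= u <= 1 ->
  \sum_(j < N.+2) bernstein N.+1 u j * phi j =
  \sum_(j < N.+1) bernstein N u j * (u * phi j.+1 + (1 - u) * phi j).
Proof.
move=> /andP[u0 u1]; have u1' : 0 <= 1 - u by rewrite subr_ge0.
rewrite /bernstein !ger0_norm//; under [RHS]eq_bigr do rewrite mulrDr.
rewrite big_split big_ord_recl /= bin0 subn0 expr0 !mul1r.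
have -> : \sum_(i < N.+1) 'C(N.+1, bump 0 i)%:R *
      (u ^+ bump 0 i * (1 - u) ^+ (N.+1 - bump 0 i)) * phi (bump 0 i) =
    \sum_(i < N.+1) 'C(N, i.+1)%:R * (u ^+ i.+1 * (1 - u) ^+ (N - i)) * phi i.+1 +
    \sum_(i < N.+1) 'C(N, i)%:R * (u ^+ i.+1 * (1 - u) ^+ (N - i)) * phi i.+1.
  rewrite -big_split; apply: eq_bigr => i _ /=.
  by rewrite /bump leq0n add1n subSS binS natrD; ring.
rewrite addrA addrC; congr (_ + _).
  by apply: eq_bigr => i _; rewrite exprS; ring.
rewrite [X in _ + X]big_ord_recr /= bin_small// !mul0r addr0.
rewrite [RHS]big_ord_recl /= bin0 subn0 expr0 !mul1r.
congr (_ + _); first by rewrite exprS; ring.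
apply: eq_bigr => i _; rewrite /bump leq0n add1n.
have -> : (N - i = (N - i.+1).+1)%N by have := ltn_ord i; lia.
by rewrite [(1 - u) ^+ _.+1]exprS; ring.
Qed.

Lemma sum_bernstein N u : 0 <= u <= 1 -> \sum_(j < N.+1) bernstein N u j = 1.
Proof.
move=> u01; have E M : \sum_(j < M.+1) bernstein M u j =
    \sum_(j < M.+1) bernstein M u j * (fun=> 1) (j : nat).
  by apply: eq_bigr => j _; rewrite mulr1.
elim: N => [|N ih]; first by rewrite big_ord1 /bernstein bin0 !mul1r.
rewrite E (sum_bernsteinS N (fun=> 1))// -[RHS]ih; apply: eq_bigr => j _.
by rewrite /= !mulr1 addrC subrK mulr1.
Qed.

(** Variance plus squared bias. The centre [x] is arbitrary because each trial moves it to
    [x - u]. *)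
Lemma bernstein_variance N u x : 0 <= u <= 1 ->
  \sum_(j < N.+1) bernstein N u j * (j%:R - x) ^+ 2 =
  N%:R * (u * (1 - u)) + (N%:R * u - x) ^+ 2.
Proof.
move=> u01; elim: N x => [|N ih] x.
  by rewrite big_ord1 /bernstein bin0 subnn !expr0 !mul1r !mul0r !add0r.
rewrite (sum_bernsteinS N (fun j => (j%:R - x) ^+ 2))//.
have -> : \sum_(j < N.+1) bernstein N u j *
      (u * (j.+1%:R - x) ^+ 2 + (1 - u) * (j%:R - x) ^+ 2) =
    u * (1 - u) * \sum_(j < N.+1) bernstein N u j +
    \sum_(j < N.+1) bernstein N u j * (j%:R - (x - u)) ^+ 2.
  rewrite mulr_sumr -big_split; apply: eq_bigr => j _ /=.
  by rewrite -[j.+1%:R]natr1; ring.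
by rewrite ih sum_bernstein// -[N.+1%:R]natr1; ring.
Qed.

Lemma sum_bernstein_mean_sq N u x : 0 <= u <= 1 ->
  \sum_(j < N.+1) bernstein N u j * ((j%:R - x) ^+ 2 + j%:R) <=
  (N%:R * u - x) ^+ 2 + 2 * N%:R.
Proof.
move=> /[dup] u01 /andP[u0 u1]; under eq_bigr do rewrite mulrDr.
rewrite big_split /= bernstein_variance//.
have : \sum_(j < N.+1) bernstein N u j * j%:R <= N%:R.
  apply: (@le_trans _ _ (\sum_(j < N.+1) bernstein N u j * N%:R)); last first.
    by rewrite -mulr_suml sum_bernstein// mul1r.
  by apply: ler_sum => j _; rewrite ler_wpM2l ?bernstein_ge0// ler_nat -ltnS.
have : u * (1 - u) <= 1 by nra.
have : 0 <= N%:R :> R by [].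
nra.
Qed.

(* [bridge_mean] with [K] size-biased picks made explicit, the Polya weights
   being replaced by binomial weights with success probabilities [u k.+1],
   [u k.+2], ... *)
Fixpoint bernstein_mean K k (u : nat -> R) N G : R :=
  match K, N with
  | 0, _ => bridge_mean k N G
  | K'.+1, 0 => G [::]
  | K'.+1, M.+1 => \sum_(j < M.+1) bernstein M (u k.+1) j *
      bernstein_mean K' k.+1 u j (fun c => G ((M.+1 - j)%N :: c))
  end.

Lemma bernstein_meanS K k (u : nat -> R) M G : bernstein_mean K.+1 k u M.+1 G =
  \sum_(j < M.+1) bernstein M (u k.+1) j *
      bernstein_mean K k.+1 u j (fun c => G ((M.+1 - j)%N :: c)).
Proof. by []. Qed.

Lemma bernstein_mean_linear K k (u : nat -> R) N G H x :
  bernstein_mean K k u N (fun c => x * G c + H c) =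
  x * bernstein_mean K k u N G + bernstein_mean K k u N H.
Proof.
elim: K k N G H => [|K ih] k [|M] G H //; try exact: bridge_mean_linear.
rewrite !bernstein_meanS mulr_sumr -big_split; apply: eq_bigr => j _ /=.
by rewrite ih; ring.
Qed.

Lemma bernstein_mean_ge0 K k (u : nat -> R) N G : (forall c, sumn c = N -> 0 <= G c) ->
  0 <= bernstein_mean K k u N G.
Proof.
elim: K k N G => [|K ih] k [|M] G G0; try exact: bridge_mean_ge0; first exact: G0.
rewrite bernstein_meanS; apply: sumr_ge0 => j _; rewrite mulr_ge0 ?bernstein_ge0// ih// => c cj.
by apply: G0; rewrite /= cj; have := ltn_ord j; lia.
Qed.

Lemma bernstein_mean_cst K k (u : nat -> R) N x : (forall i, 0 <= u i <= 1) ->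
  bernstein_mean K k u N (fun=> x) = x.
Proof.
move=> u01; elim: K k N => [|K ih] k N.
  rewrite /= (_ : (fun=> x) = fun c : seq nat => (x - 1) * (fun=> 1) c + (fun=> 1) c).
    by rewrite bridge_mean_linear bridge_mean1 mulr1 subrK.
  by apply/funext => c; rewrite mulr1 subrK.
case: N => // M; rewrite bernstein_meanS; under eq_bigr do rewrite ih.
by rewrite -mulr_suml sum_bernstein// mul1r.
Qed.

Lemma bernstein_mean_le K k (u : nat -> R) N G H : (forall c, sumn c = N -> G c <= H c) ->
  bernstein_mean K k u N G <= bernstein_mean K k u N H.
Proof.
move=> GH; rewrite -subr_ge0.
have := bernstein_mean_linear K k u N G H (-1); rewrite mulN1r addrC => <-.
by apply: bernstein_mean_ge0 => c /GH; rewrite mulN1r addrC subr_ge0.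
Qed.

Lemma bernstein_mean_dist K k (u : nat -> R) N G H x : (forall i, 0 <= u i <= 1) ->
  (forall c, sumn c = N -> `|G c - x| <= H c) ->
  `|bernstein_mean K k u N G - x| <= bernstein_mean K k u N H.
Proof.
move=> u01 GH; have E y : bernstein_mean K k u N (fun c => y * H c + x) =
    y * bernstein_mean K k u N H + x.
  by rewrite (bernstein_mean_linear K k u N H (fun=> x) y) bernstein_mean_cst.
rewrite ler_distl; apply/andP; split.
  by rewrite addrC -mulN1r -E; apply: bernstein_mean_le => c /GH; rewrite ler_distl; lra.
rewrite addrC -[bernstein_mean K k u N H]mul1r -E.
by apply: bernstein_mean_le => c /GH; rewrite ler_distl; lra.
Qed.

(* Squared distances between the masses left after each of the first [K] picks
   [c] from [x], and the masses left after removing from [t] the fractions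
   [1 - u k], [1 - u k.+1], ... *)
Fixpoint pick_dist K k (u : nat -> R) t x (c : seq nat) : R :=
  if K is K'.+1 then
    (x - (head 0 c)%:R - t * u k) ^+ 2 +
    pick_dist K' k.+1 u (t * u k) (x - (head 0 c)%:R) (behead c)
  else 0.

Lemma pick_dist_ge0 K k (u : nat -> R) t x c : 0 <= pick_dist K k u t x c.
Proof. by elim: K k t x c => //= K ih k t x c; rewrite addr_ge0// sqr_ge0. Qed.

Lemma pick_dist_nil K k (u : nat -> R) t : (forall i, 0 <= u i <= 1) ->
  pick_dist K k u t 0 [::] <= K%:R * t ^+ 2.
Proof.
move=> u01; elim: K k t => [|K ih] k t /=; first by rewrite mul0r.
rewrite subrr sub0r sqrrN -[K.+1%:R]natr1 mulrDl mul1r addrC.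
have tu : (t * u k) ^+ 2 <= t ^+ 2.
  by rewrite exprMn ler_piMr ?sqr_ge0// expr_le1//; case/andP: (u01 k).
apply: lerD => //; apply: le_trans (ih _ _) _; by rewrite ler_wpM2l.
Qed.

(** What matters is that the bound depends on [K] alone. With [A] the bound for [K'], one more pick
    costs [2 (1 + A)]; the remaining [1 + 2 A] is slack. *)
Fixpoint pick_bound K : R := if K is K'.+1 then 3 + 4 * pick_bound K' else 0.

Lemma pick_bound_ge K : K%:R <= pick_bound K.
Proof.
elim: K => //= K ih; rewrite -[K.+1%:R]natr1.
have : 0 <= K%:R :> R by [].
lra.
Qed.

(** [(N - t)^2] is the error inherited from earlier picks, [N] the order of the variance added by a
    new one. Both are present in the bound because the mass [j] left by a pick is the number of
    units in the next. *)
Lemma bernstein_mean_pick_dist K k (u : nat -> R) t N : (forall i, 0 <= u i <= 1) ->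
  bernstein_mean K k u N (fun c => pick_dist K k.+1 u t N%:R c) <=
  pick_bound K * ((N%:R - t) ^+ 2 + N%:R).
Proof.
move=> u01; elim: K k t N => [|K ih] k t N.
  by rewrite mul0r (bernstein_mean_cst 0).
case: N => [|M].
  rewrite [bernstein_mean _ _ _ _ _]/= -/(pick_dist K.+1 k.+1 u t 0 [::]).
  apply: le_trans (pick_dist_nil _ _ _ u01) _.
  by rewrite addr0 sub0r sqrrN ler_wpM2r ?sqr_ge0// pick_bound_ge.
set v := u k.+1; have v01 : 0 <= v <= 1 by exact: u01.
have AK : 0 <= pick_bound K by rewrite (le_trans _ (pick_bound_ge K)).
apply: (@le_trans _ _ (\sum_(j < M.+1) bernstein M v j *
    ((j%:R - t * v) ^+ 2 + pick_bound K * ((j%:R - t * v) ^+ 2 + j%:R)))).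
  rewrite bernstein_meanS; apply: ler_sum => j _; rewrite ler_wpM2l ?bernstein_ge0//.
  have jM : M.+1%:R - (M.+1 - j)%:R = j%:R :> R.
    by rewrite natrB ?subKr// (ltnW (ltn_ord j)).
  rewrite (_ : (fun c => _) = fun c : seq nat => 1 * (fun=> (j%:R - t * v) ^+ 2) c +
      pick_dist K k.+2 u (t * v) j%:R c); last by apply/funext => c; rewrite /= jM mul1r.
  by rewrite bernstein_mean_linear bernstein_mean_cst// mul1r lerD2l.
rewrite (eq_bigr (fun j : 'I_M.+1 => (1 + pick_bound K) *
    (bernstein M v j * ((j%:R - t * v) ^+ 2 + j%:R)) - bernstein M v j * j%:R)); last first.
  by move=> j _; ring.
rewrite sumrB -mulr_sumr.
have S0 : 0 <= \sum_(j < M.+1) bernstein M v j * j%:R.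
  by apply: sumr_ge0 => j _; rewrite mulr_ge0 ?bernstein_ge0.
have := sum_bernstein_mean_sq M (t * v) v01.
move: (\sum_(_ < _) _) (\sum_(_ < _) _) S0 => S1 S2 S0 S21.
rewrite [pick_bound K.+1]/= -[M.+1%:R]natr1.
have M0 : 0 <= M%:R :> R by [].
(* The forced unit makes [M] trials out of the mass [M + 1]. With [x = M + 1 - t], the shift costs
   [(x - 1)^2 <= 2 x^2 + 2], which is [(x + 1)^2 >= 0]. *)
have step : (M%:R * v - t * v) ^+ 2 + 2 * M%:R <= 2 * ((M%:R + 1 - t) ^+ 2 + (M%:R + 1)).
  rewrite -mulrBl exprMn; move/andP: v01 => [v0 v1].
  have : (M%:R - t) ^+ 2 * v ^+ 2 <= (M%:R - t) ^+ 2.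
    by rewrite ler_piMr ?sqr_ge0// expr_le1.
  have : 0 <= (M%:R + 1 - t - 1 + 2) ^+ 2 by exact: sqr_ge0.
  rewrite !expr2; nra.
have := ler_wpM2l (addr_ge0 ler01 AK) (le_trans S21 step).
have q0 : 0 <= (M%:R + 1 - t) ^+ 2 + (M%:R + 1).
  by rewrite addr_ge0 ?sqr_ge0// addr_ge0.
move: ((M%:R + 1 - t) ^+ 2 + _) q0 => q q0 le1.
have : 0 <= (1 + 2 * pick_bound K) * q by rewrite mulr_ge0//; lra.
move=> le2; rewrite -subr_ge0.
rewrite -subr_ge0 in le1; apply: le_trans (addr_ge0 (addr_ge0 le2 S0) le1) _.
rewrite le_eqVlt; apply/orP; left; apply/eqP; ring.
Qed.

(** There are [K + 1] picks in all: the extra one, with parameter [u 0] and [n] trials, is the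
    current age. *)
Definition picks_mean K (u : nat -> R) n G : R := \sum_(j < n.+1)
  bernstein n (u 0%N) j * bernstein_mean K 0 u j (fun c => G ((n - j)%N :: c)).

Lemma picks_mean_dist K (u : nat -> R) n G H x : (forall i, 0 <= u i <= 1) ->
  (forall c, sumn c = n -> `|G c - x| <= H c) ->
  `|picks_mean K u n G - x| <= picks_mean K u n H.
Proof.
move=> u01 GH.
have -> : picks_mean K u n G - x = \sum_(j < n.+1) bernstein n (u 0%N) j *
    (bernstein_mean K 0 u j (fun c => G ((n - j)%N :: c)) - x).
  under [RHS]eq_bigr do rewrite mulrBr.
  by rewrite sumrB -mulr_suml sum_bernstein// mul1r.
apply: le_trans (ler_norm_sum _ _ _) _; apply: ler_sum => j _.
rewrite normrM ger0_norm ?bernstein_ge0// ler_wpM2l ?bernstein_ge0//.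
apply: bernstein_mean_dist => // c cj; apply: GH => /=.
by rewrite cj subnK// -ltnS.
Qed.

(** Starting from [t = n] there is no inherited error, so the squared distance has mean of order
    [n], and of order [1/n] after rescaling by [n]. *)
Lemma picks_mean_pick_dist K (u : nat -> R) n x y : (forall i, 0 <= u i <= 1) -> 0 <= x ->
  picks_mean K u n (fun c => x * pick_dist K.+1 0 u n%:R n%:R c + y) <=
  x * ((1 + 2 * pick_bound K) * n%:R) + y.
Proof.
move=> u01 x0; have A0 : 0 <= pick_bound K by rewrite (le_trans _ (pick_bound_ge K)).
set v := u 0%N; have v01 : 0 <= v <= 1 by exact: u01.
apply: (@le_trans _ _ (\sum_(j < n.+1) (bernstein n v j *
    (x * ((j%:R - n%:R * v) ^+ 2 + pick_bound K * ((j%:R - n%:R * v) ^+ 2 + j%:R)) + y)))).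
  apply: ler_sum => j _; rewrite ler_wpM2l ?bernstein_ge0//.
  have jn : n%:R - (n - j)%:R = j%:R :> R by rewrite natrB ?subKr// -ltnS.
  rewrite (_ : (fun c => _) = fun c : seq nat => x * pick_dist K 1 u (n%:R * v) j%:R c +
      (fun=> x * (j%:R - n%:R * v) ^+ 2 + y) c); last first.
    by apply/funext => c; rewrite /= jn -/v; move: (pick_dist _ _ _ _ _ _) => w; ring.
  rewrite bernstein_mean_linear bernstein_mean_cst// addrA lerD2r mulrDr addrC lerD2l.
  by rewrite ler_wpM2l// bernstein_mean_pick_dist.
rewrite (eq_bigr (fun j : 'I_n.+1 => x * ((1 + pick_bound K) *
    (bernstein n v j * (j%:R - n%:R * v) ^+ 2) + pick_bound K * (bernstein n v j * j%:R))
    + bernstein n v j * y)); last by move=> j _; ring.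
rewrite big_split -mulr_suml sum_bernstein// mul1r lerD2r -mulr_sumr ler_wpM2l//.
rewrite big_split -!mulr_sumr /= bernstein_variance// subrr expr0n addr0.
have S1 : \sum_(j < n.+1) bernstein n v j * j%:R <= n%:R.
  apply: (@le_trans _ _ (\sum_(j < n.+1) bernstein n v j * n%:R)); last first.
    by rewrite -mulr_suml sum_bernstein// mul1r.
  by apply: ler_sum => j _; rewrite ler_wpM2l ?bernstein_ge0// ler_nat -ltnS.
have S2 : n%:R * (v * (1 - v)) <= n%:R :> R.
  by rewrite ler_piMr//; nra.
rewrite (_ : (1 + 2 * _) * _ = (1 + pick_bound K) * n%:R + pick_bound K * n%:R); last by ring.
by rewrite lerD// ler_wpM2l// addr_ge0.
Qed.

End bernstein.

(** * From picks to sticks *)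

Section picks.
Context {R : realType}.
Implicit Types (u : nat -> R) (c : seq nat).

Lemma pick_dist_ge K k u (t x : R) c i : (i < K)%N ->
  (x - (sumn (take i.+1 c))%:R - t * \prod_(j < i.+1) u (k + j)%N) ^+ 2 <=
  pick_dist K k u t x c.
Proof.
elim: K k t x c i => // K ih k t x c [|i] iK /=.
  rewrite big_ord1 addn0 (_ : sumn _ = head 0%N c); last first.
    by case: c => //= a c; rewrite take0 addn0.
  by rewrite lerDl pick_dist_ge0.
have -> : sumn (take i.+2 c) = (head 0%N c + sumn (take i.+1 (behead c)))%N.
  by case: c.
apply: le_trans (_ : pick_dist K k.+1 u (t * u k) (x - (head 0%N c)%:R) (behead c) <= _).
  apply: le_trans (ih k.+1 _ _ _ i iK).
  rewrite natrD [in leLHS]big_ord_recl addn0 opprD addrA mulrA.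
  have -> : \prod_(j < i.+1) u (k + bump 0 j)%N = \prod_(j < i.+1) u (k.+1 + j)%N.
    by apply: eq_bigr => j _; rewrite /bump leq0n add1n addSnnS.
  by [].
by rewrite lerDr sqr_ge0.
Qed.

Lemma sumn_take_nth c i : sumn (take i.+1 c) = (sumn (take i c) + nth 0%N c i)%N.
Proof.
elim: c i => [|a c ih] [|i] //=; first by rewrite take0 addn0.
by rewrite ih addnA.
Qed.

Lemma stick_breakingE u i : stick_breaking u i =
  \prod_(j < i) u j - \prod_(j < i.+1) u j.
Proof. by rewrite /stick_breaking big_ord_recr /= mulrBl mul1r [X in _ - X]mulrC. Qed.

Lemma prod_unit_decr u i j : (forall k, 0 <= u k <= 1) -> (i <= j)%N ->
  \prod_(k < j) u k <= \prod_(k < i) u k.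
Proof.
move=> u01 /subnK <-; elim: (j - i)%N => // m ih; apply: le_trans ih.
rewrite addSn big_ord_recr /= ler_piMr ?(andP (u01 _)).2//.
by apply: prodr_ge0 => k _; case/andP: (u01 k).
Qed.

Lemma prod_unit_ge0 u i : (forall k, 0 <= u k <= 1) -> 0 <= \prod_(k < i) u k.
Proof. by move=> u01; apply: prodr_ge0 => k _; case/andP: (u01 k). Qed.

(** Picks and sticks are differences of consecutive remainders. For [i < K] both remainders are
    within [D] of each other's counterpart, whence [2 D]. From [K] on, the pick and the stick are
    each bounded by the remainder at [K], which gives the product term. *)
Lemma picks_stick_breaking K u n c i : (forall k, 0 <= u k <= 1) -> sumn c = n ->
  `|(nth 0%N c i)%:R - n%:R * stick_breaking u i| <=
  n%:R * \prod_(j < K) u j + 2 * Num.sqrt (pick_dist K 0 u n%:R n%:R c).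
Proof.
move=> u01 cn; set D := Num.sqrt _.
have D0 : 0 <= D by exact: sqrtr_ge0.
pose r i := n%:R - (sumn (take i c))%:R : R; pose q i := \prod_(j < i) u j.
have q0 j : 0 <= q j by exact: prod_unit_ge0.
have close j : (j <= K)%N -> `|r j - n%:R * q j| <= D.
  case: j => [|j] jK; first by rewrite /r /q big_ord0 take0 /= subr0 mulr1 subrr normr0.
  by rewrite -sqrtr_sqr ler_wsqrtr//; exact: (@pick_dist_ge K 0 u _ _ c j jK).
have cE : (nth 0%N c i)%:R = r i - r i.+1.
  by rewrite /r sumn_take_nth natrD; ring.
have r_decr j m : (j <= m)%N -> r m <= r j.
  move=> /subnK <-; elim: (m - j)%N => // k ih; apply: le_trans ih.
  by rewrite addSn /r sumn_take_nth natrD; have : 0 <= (nth 0%N c (k + j))%:R :> R by []; lra.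
have r0 j : 0 <= r j.
  by rewrite subr_ge0 ler_nat -cn -{2}(cat_take_drop j c) sumn_cat leq_addr.
have n0 : 0 <= n%:R :> R by [].
rewrite stick_breakingE -/(q i) -/(q i.+1); have [iK|Ki] := ltnP i K.
  have := close _ (ltnW iK); have := close _ iK; rewrite cE.
  have : 0 <= n%:R * q K by rewrite mulr_ge0.
  by rewrite -/(q K) !ler_norml; lra.
have rK := r_decr _ _ Ki; have qK := prod_unit_decr u01 Ki.
have qi := prod_unit_decr u01 (leqnSn i).
have := close _ (leqnn K); rewrite -/(q K) !ler_norml.
have : n%:R * q i <= n%:R * q K by rewrite ler_wpM2l.
have : n%:R * q i.+1 <= n%:R * q i by rewrite ler_wpM2l.
have : 0 <= n%:R * q i.+1 by rewrite mulr_ge0.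
have : 0 <= (nth 0%N c i)%:R :> R by [].
rewrite cE; have := r0 i.+1; lra.
Qed.

End picks.

(** * Ranking and the sup distance *)

Section rearrangements.
Context {R : realType}.

Lemma decreasing_rearrangement_le (a v x y : nat -> R) (e : R) :
  decreasing_rearrangement a x -> decreasing_rearrangement v y ->
  (forall i, a i <= v i + e) -> forall k, x k <= y k + e.
Proof.
move=> [ndx [p bp xa]] [ndy [s [s' ss' s's] yv]] av k.
(* Pigeonhole: the [k + 1] largest terms of [a] cannot all occupy the first [k] ranks of [v]. *)
have [i ik ki] : exists2 i : nat, (i <= k)%N & (k <= s' (p i))%N.
  apply: contrapT => nex.
  have lt_k (i : 'I_k.+1) : (s' (p i) < k)%N.
    by rewrite ltnNge; apply/negP => ki; apply: nex; exists i => //; rewrite -ltnS.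
  have /leq_card : injective (fun i : 'I_k.+1 => Ordinal (lt_k i)).
    move=> i j [/(can_inj s's)/(bij_inj bp)]; exact: val_inj.
  by rewrite !card_ord ltnn.
apply: le_trans (ndx _ _ ik) _; rewrite xa; apply: le_trans (av _) _.
by rewrite lerD2r -[v _]/(v (p i)) -(s's (p i)) -yv; exact: ndy.
Qed.

Lemma decreasing_rearrangement_dist (a v x y : nat -> R) (e : R) :
  decreasing_rearrangement a x -> decreasing_rearrangement v y ->
  (forall i, `|a i - v i| <= e) -> forall k, `|x k - y k| <= e.
Proof.
move=> ax vy av k; rewrite ler_distl.
have av1 i : a i <= v i + e by have := av i; rewrite ler_distl => /andP[].
have va1 i : v i <= a i + e by have := av i; rewrite distrC ler_distl => /andP[].
rewrite (decreasing_rearrangement_le ax vy av1) lerBlDr.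
by rewrite (decreasing_rearrangement_le vy ax va1).
Qed.

Lemma sort_decreasing_rearrangement (c : seq nat) (n : nat) :
  decreasing_rearrangement (fun i => (nth 0%N c i)%:R / n%:R : R)
    (fun k => (nth 0%N (sort geq c) k)%:R / n%:R).
Proof.
have geq_total : total geq by move=> i j; exact: leq_total.
have geq_trans : transitive geq by move=> i j k ij jk; exact: leq_trans jk ij.
split.
  move=> i j ij; rewrite ler_wpM2r ?invr_ge0// ler_nat.
  have [jc|cj] := ltnP j (size (sort geq c)); last by rewrite (nth_default _ cj).
  have ic := leq_ltn_trans ij jc.
  have := sorted_leq_nth geq_trans (fun i => leqnn i) 0%N (sort_sorted geq_total c).
  by apply => //; rewrite inE.
have /(perm_iotaP 0%N)[Is pIs sE] : perm_eq (sort geq c) c by rewrite perm_sort.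
have sIs : size Is = size c by rewrite (perm_size pIs) size_iota.
(* The sorting permutation is extended by the identity past the end of [c], where both sequences are
   0. *)
pose s k := if (k < size c)%N then nth 0%N Is k else k.
pose s' k := if (k < size c)%N then index k Is else k.
have uIs : uniq Is by rewrite (perm_uniq pIs) iota_uniq.
have ltIs k : (k < size c)%N = (k \in Is) by rewrite (perm_mem pIs) mem_iota.
exists s.
  exists s' => k; rewrite /s /s'; have [kc|ck] := ltnP k (size c).
  - by rewrite ltIs mem_nth ?sIs// index_uniq// sIs.
  - by rewrite ltnNge ck.
  - by rewrite -sIs index_mem -ltIs kc nth_index// -ltIs.
  - by rewrite ltnNge ck.
move=> k; congr (_%:R / _); rewrite sE /s; case: ifPn => kc.
  by rewrite (nth_map 0%N)// sIs.
by rewrite !nth_default ?size_map ?sIs// leqNgt.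
Qed.

End rearrangements.

(** * Continuous functions on the cube *)

Lemma ptws_cvg (R : realType) (F : set_system (nat -> R)) (x : nat -> R) :
  Filter F -> (forall t, (fun g => g t) @ F --> x t) -> {ptws, F --> x}.
Proof. by move=> FF h; apply (pointwise_cvgP x FF).2; exact: h. Qed.

Section unit_cube.
Context {R : realType}.
Local Notation S := {ptws nat -> R}.
Implicit Types (x y : S) (f : S -> R).

Lemma unit_cubeP x : unit_cube x <-> forall k, 0 <= x k <= 1.
Proof. by split => h k; have := h k; rewrite in_itv. Qed.

Lemma unit_cube_compact : compact (@unit_cube R).
Proof.
apply: (@tychonoff nat (fun=> R) (fun=> [set` `[0, 1] : interval R])) => _.
exact: segment_compact.
Qed.

Lemma unit_cube_continuous_bounded f : {within @unit_cube R, continuous f} ->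
  exists2 M : R, 0 <= M & forall x, unit_cube x -> `|f x| <= M.
Proof.
move=> cf; have := compact_bounded (continuous_compact cf unit_cube_compact).
move=> [M [_ HM]]; exists (Num.max 0 (M + 1)); first by rewrite le_max lexx.
move=> x cx; apply: (HM (Num.max 0 (M + 1))); last by exists x.
by rewrite lt_max ltrDl ltr01 orbT.
Qed.

(** Continuity is for the product topology, but sup-close sequences are also close coordinatewise;
    compactness of the cube makes the radius uniform. *)
Lemma unit_cube_unif_continuous f : {within @unit_cube R, continuous f} ->
  forall e, 0 < e -> exists2 r : R, 0 < r & forall x y,
    unit_cube x -> unit_cube y -> (forall k, `|x k - y k| <= r) -> `|f x - f y| <= e.
Proof.
move=> cf e e0.
pose P (r : R) x := forall y, unit_cube y -> (forall k, `|x k - y k| <= r) -> `|f x - f y| <= e.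
suff : \forall r \near 0^'+, @unit_cube R `<=` P r.
  move=> [r /= r0 /(_ (r / 2))] H; exists (r / 2); first by rewrite divr_gt0.
  move=> x y cx cy; apply: (H _ _ x) => //=; last by rewrite divr_gt0.
  by rewrite sub0r normrN gtr0_norm ?divr_gt0// ltr_pdivrMr// ltr_pMr// ltr1n.
have /compact_near_coveringP/near_covering_withinP := unit_cube_compact.
apply => x cx.
have := cf; move/subspace_continuousP => /(_ x cx)/cvgrPdist_lt/(_ (e / 2)).
rewrite divr_gt0// => /(_ isT) nearx.
(* [F0] is uniform smallness. Adding a uniformly small sequence to one that tends to [x] pointwise
   still gives pointwise convergence to [x], so [f] is within [e / 2] of [f x] at both points. *)
pose F0 : set_system (nat -> R) := filter_from [set r : R | 0 < r]
  (fun r => [set z | forall k, `|z k| <= r]).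
have FF0 : Filter F0.
  apply: filter_from_filter; first by exists 1 => /=.
  move=> r1 r2 /= r10 r20; exists (Num.min r1 r2); first by rewrite /= lt_min r10.
  by move=> z /= zr; split => k /=; have := zr k; rewrite le_min => /andP[].
pose add (p : S * (nat -> R)) : nat -> R := fun k => p.1 k + p.2 k.
pose Fx : set_system (nat -> R) := add @ filter_prod (nbhs x) F0.
have Fprod : Filter (filter_prod (nbhs x) F0) by apply: filter_prod_filter.
have FFx : Filter Fx by apply: fmap_filter.
have cvg_coord t : (fun g : nat -> R => g t) @ Fx --> x t.
  apply/cvgrPdist_lt => r r0 /=.
  have r20 : 0 < r / 2 by rewrite divr_gt0.
  have near_x : nbhs x [set y : S | `|x t - y t| < r / 2].
    exact: (@proj_continuous nat (fun=> R) t x _ (nbhsx_ballx (x t) (r / 2) r20)).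
  exists ([set y : S | `|x t - y t| < r / 2], [set z : nat -> R | forall k, `|z k| <= r / 2]).
    by split => //=; exists (r / 2) => //=; rewrite divr_gt0.
  move=> [y z] [/= yr /(_ t) zr]; rewrite /add /=.
  have -> : x t - (y t + z t) = (x t - y t) - z t by ring.
  apply: le_lt_trans (ler_normB _ _) _; rewrite [ltRHS]splitr.
  exact: ltr_leD.
have /(_ _ nearx)[[V Z] /= [xV [r /= r0 rZ]] VZ] := @ptws_cvg R Fx x FFx cvg_coord.
exists (V, [set s : R | 0 < s <= r]).
  split => //=; near=> s; apply/andP; split; near: s; first exact: nbhs_right_gt.
  exact: nbhs_right_le.
have xx : `|f x - f x| < e / 2 by rewrite subrr normr0 divr_gt0.
move=> [y s] /= [Vy /andP[s0 sr]] cy z cz yz.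
have close_x y' : V y' -> forall z', unit_cube z' -> (forall k, `|y' k - z' k| <= r) ->
    `|f x - f z'| < e / 2.
  move=> Vy' z' cz' yz'; pose w k := z' k - y' k.
  have zE : add (y', w) = z' by apply/funext => k; rewrite /add /w /= addrC subrK.
  have Zw : Z w by apply: rZ => k; rewrite /= distrC.
  by have := VZ (y', w) (conj Vy' Zw); rewrite /= zE => /(_ cz').
have fy : `|f x - f y| < e / 2.
  by apply: (close_x y) => // k; rewrite subrr normr0 ltW.
have fz : `|f x - f z| < e / 2.
  by apply: (close_x y) => // k; exact: le_trans (yz k) sr.
by move: fy fz; rewrite !ltr_norml ler_norml; lra.
Unshelve. all: by end_near. Qed.

Lemma unit_cube_open_setC : open (~` @unit_cube R).
Proof.
rewrite (_ : ~` _ = \bigcup_k (proj k @^-1` (~` `[0, 1]%classic : set R))).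
  apply: bigcup_open => k _; apply: open_comp => [x _|]; first exact: proj_continuous.
  by rewrite openC; exact: interval_closed.
apply/seteqP; split => x /=; first by move=> /existsNP[k xk]; exists k.
by move=> [k _ xk]; apply/existsNP; exists k.
Qed.

Lemma measurable_unit_cube : measurable (@unit_cube R : set (sequence_space R)).
Proof.
rewrite -[X in measurable X]setCK; apply: measurableC.
by apply: sub_gen_smallest; exact: unit_cube_open_setC.
Qed.

Lemma measurable_unit_cube_continuous f : {within @unit_cube R, continuous f} ->
  measurable_fun (@unit_cube R : set (sequence_space R)) (f : sequence_space R -> R).
Proof.
move=> /continuousP cf; apply: (measurability _ (RGenOInfty.measurableE R)).
move=> _ [_ [a ->] <-].
have /open_subspaceP[V oV VE] := cf _ (@open_gt R a).
have -> : @unit_cube R `&` f @^-1` `]a, +oo[ = V `&` @unit_cube R.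
  rewrite VE setIC; congr (_ `&` _); apply/seteqP; split => x /=; by rewrite in_itv/= andbT.
apply: measurableI; last exact: measurable_unit_cube.
exact: sub_gen_smallest.
Qed.

End unit_cube.

(** * Convergence to the Poisson-Dirichlet law *)

Section measurable_bernstein_mean.
Context {R : realType}.
Local Notation seqs D := (@g_sigma_algebraType (nat -> R) (cylinder D)).

Lemma measurable_bernstein (N j : nat) : measurable_fun setT (fun u : R => bernstein N u j).
Proof.
have m1 : measurable_fun setT (fun t : R => 1 - t) by exact: measurable_funB.
apply: measurable_funM => //; apply: measurable_funM; apply: measurable_funX.
  exact: normr_measurable.
by have := measurableT_comp (@normr_measurable R setT) m1.
Qed.

Lemma measurable_bernstein_mean K k (D : set nat) N (G : seq nat -> R) :
  [set i | (k < i)%N] `<=` D ->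
  measurable_fun setT (fun e : seqs D => bernstein_mean K k e N G).
Proof.
elim: K k N G => [|K ih] k N G kD /=; first exact: measurable_cst.
case: N => [|N]; first exact: measurable_cst.
apply: measurable_sum => j; apply: measurable_funM.
  apply: (measurableT_comp (measurable_bernstein N j)).
  by apply: measurable_coordinate; apply: kD => /=.
by apply: ih => i /= ki; apply: kD => /=; exact: ltnW.
Qed.

End measurable_bernstein_mean.

(** * Averaging over the beta variables *)

Section size_biased_sticks.
Context d (T : measurableType d) (R : realType) (Q : probability T R).
Variable U : nat -> {RV Q >-> R}.
Hypothesis Uindep : mutually_independent U.
Hypothesis Ubeta : forall i, beta_law (0 + i.+1%:R * (1 / 2)) (1 - 1 / 2) (U i).
Local Notation seqs D := (@g_sigma_algebraType (nat -> R) (cylinder D)).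
Let path := path_of U.

Let int_cst (x : R) : (\int[Q]_w x%:E = x%:E)%E.
Proof. by rewrite integral_cst//; rewrite [X in (_ * X)%E]probability_setT mule1. Qed.

Let a_gt0 i : 0 < 0 + i.+1%:R * (1 / 2) :> R.
Proof. by rewrite add0r mulr_gt0. Qed.

Let b_gt0 : 0 < 1 - 1 / 2 :> R.
Proof. lra. Qed.

Lemma bernstein_expectation i N j : (j <= N)%N ->
  (\int[Q]_w (bernstein N (U i w) j)%:E = (polya_weight i N j)%:E)%E.
Proof.
move=> jN; rewrite /bernstein (beta_bernstein (a_gt0 i) b_gt0 (Ubeta i) jN).
congr EFin; rewrite /polya_weight; congr (neg_binom _ _ * neg_binom _ _ / neg_binom _ _).
- by rewrite add0r mul1r.
- by lra.
- by rewrite -[i.+2%:R]natr1 add0r; lra.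
Qed.

(** [U k.+1] is independent of the later variables and its binomial weights average to the Polya
    weights. The recursion of [bridge_meanS] is thus reproduced exactly, for every [K] and [N]. *)
Lemma bernstein_mean_expectation K k N (G : seq nat -> R) :
  (forall c, 0 <= G c) -> perm_inv G ->
  (\int[Q]_w (bernstein_mean K k (path w) N G)%:E = (bridge_mean k N G)%:E)%E.
Proof.
elim: K k N G => [|K ih] k N G G0 PG; first by rewrite /= int_cst.
case: N => [|N]; first by rewrite /= int_cst bridge_mean0.
under eq_integral do rewrite bernstein_meanS -sumEFin.
pose D1 := [set k.+1]; pose D2 := [set i | (k.+1 < i)%N].
pose H j (c : seq nat) := G ((N.+1 - j)%N :: c).
have H0 j c : 0 <= H j c by exact: G0.
have m1 j : measurable_fun setT (fun e : seqs D1 => bernstein N (e k.+1) j).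
  apply: (measurableT_comp (measurable_bernstein N j)).
  exact: measurable_coordinate.
have m2 j : measurable_fun setT (fun e : seqs D2 => bernstein_mean K k.+1 e j (H j)).
  exact: measurable_bernstein_mean.
have mQ D (f : seqs D -> R) : measurable_fun setT f -> measurable_fun setT (fun w => f (path w)).
  by move=> mf; apply: (measurableT_comp mf); exact: measurable_path_of.
have bm0 j e : 0 <= bernstein_mean K k.+1 e j (H j) by apply: bernstein_mean_ge0.
rewrite ge0_integral_sum//; last 2 first.
- move=> j; apply/measurable_EFinP; apply: measurable_funM.
    exact: (mQ _ _ (m1 j)).
  exact: (mQ _ _ (m2 j)).
- by move=> j w _; rewrite lee_fin mulr_ge0 ?bernstein_ge0//; exact: bm0.
rewrite bridge_meanS// -sumEFin; apply: eq_bigr => j _.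
under eq_integral do rewrite EFinM.
rewrite (@independent_integralM _ _ _ Q U Uindep D1 D2
  (fun e => (bernstein N (e k.+1) j)%:E) (fun e => (bernstein_mean K k.+1 e j (H j))%:E)).
- have jN : (j <= N)%N by rewrite -ltnS.
  rewrite EFinM; congr (_ * _)%E; first exact: (bernstein_expectation k.+1 jN).
  exact: (ih k.+1 j (H j) (H0 j) (perm_inv_cons _ PG)).
- by apply/seteqP; split => // i [/= ->]; rewrite /D2 /= ltnn.
- exact/measurable_EFinP.
- by move=> e; rewrite lee_fin bernstein_ge0.
- exact/measurable_EFinP.
- by move=> e; rewrite lee_fin bm0.
Qed.

Lemma picks_mean_expectation K n (G : seq nat -> R) : (forall c, 0 <= G c) -> perm_inv G ->
  (\int[Q]_w (picks_mean K (path w) n G)%:E = (renewal_mean n G)%:E)%E.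
Proof.
move=> G0 PG; under eq_integral do rewrite -sumEFin.
pose D1 := [set 0%N]; pose D2 := [set i | (0 < i)%N].
pose H j (c : seq nat) := G ((n - j)%N :: c).
have m1 j : measurable_fun setT (fun e : seqs D1 => bernstein n (e 0%N) j).
  apply: (measurableT_comp (measurable_bernstein n j)).
  exact: measurable_coordinate.
have m2 j : measurable_fun setT (fun e : seqs D2 => bernstein_mean K 0 e j (H j)).
  exact: measurable_bernstein_mean.
have mQ D (f : seqs D -> R) : measurable_fun setT f -> measurable_fun setT (fun w => f (path w)).
  by move=> mf; apply: (measurableT_comp mf); exact: measurable_path_of.
have bm0 j e : 0 <= bernstein_mean K 0 e j (H j) by apply: bernstein_mean_ge0 => c _; exact: G0.
rewrite ge0_integral_sum//; last 2 first.
- move=> j; apply/measurable_EFinP; apply: measurable_funM.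
    exact: (mQ _ _ (m1 j)).
  exact: (mQ _ _ (m2 j)).
- by move=> j w _; rewrite lee_fin mulr_ge0 ?bernstein_ge0//; exact: bm0.
rewrite renewal_meanE// -sumEFin; apply: eq_bigr => j _.
under eq_integral do rewrite EFinM.
rewrite (@independent_integralM _ _ _ Q U Uindep D1 D2
  (fun e => (bernstein n (e 0%N) j)%:E) (fun e => (bernstein_mean K 0 e j (H j))%:E)).
- have jn : (j <= n)%N by rewrite -ltnS.
  rewrite EFinM; congr (_ * _)%E; first exact: (bernstein_expectation 0 jn).
  exact: (bernstein_mean_expectation K 0 j (fun c => G0 _) (perm_inv_cons _ PG)).
- by apply/seteqP; split => // i [/= ->]; rewrite /D2 /= ltnn.
- exact/measurable_EFinP.
- by move=> e; rewrite lee_fin bernstein_ge0.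
- exact/measurable_EFinP.
- by move=> e; rewrite lee_fin bm0.
Qed.

(** The means [(k+1) / (k+2)] of the factors telescope. The limit 0 as [K] grows is what makes
    finitely many picks enough. *)
Lemma stick_remainder_expectation K k :
  (\int[Q]_w (\prod_(j < K) `|path w (k + j)%N|)%:E = (k.+1%:R / (k + K).+1%:R)%:E)%E.
Proof.
have k0 m : m.+1%:R != 0 :> R by rewrite pnatr_eq0.
elim: K k => [|K ih] k.
  under eq_integral do rewrite big_ord0.
  by rewrite int_cst addn0 divff.
pose D1 := [set k]; pose D2 := [set i | (k < i)%N].
under eq_integral do rewrite big_ord_recl addn0 EFinM.
have m1 : measurable_fun setT (fun e : seqs D1 => `|e k| : R).
  apply: (measurableT_comp (@normr_measurable R setT)).
  exact: measurable_coordinate.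
have m2 : measurable_fun setT (fun e : seqs D2 => \prod_(j < K) `|e (k + bump 0 j)%N| : R).
  apply: measurable_prod => j _.
  apply: (measurableT_comp (@normr_measurable R setT)).
  by apply: measurable_coordinate; rewrite /D2 /= /bump leq0n; lia.
rewrite (@independent_integralM _ _ _ Q U Uindep D1 D2 (fun e => (`|e k|)%:E)
  (fun e => (\prod_(j < K) `|e (k + bump 0 j)%N|)%:E)).
- have -> : (\int[Q]_w (`|path_of U w k|)%:E = (k.+1%:R / k.+2%:R)%:E)%E.
    have := beta_bernstein (a_gt0 k) b_gt0 (Ubeta k) (leqnn 1).
    under eq_integral do rewrite binn mul1r subnn expr1 expr0 mulr1.
    move=> ->; congr EFin; rewrite subnn neg_binom0 mulr1.
    rewrite /neg_binom !big_ord1 !addr0 !divr1.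
    have -> : 0 + k.+1%:R * (1 / 2) + (1 - 1 / 2) = k.+2%:R / 2 :> R.
      by rewrite -[k.+2%:R]natr1; lra.
    by rewrite add0r; field; rewrite ?k0 -?natr1.
  have -> : (\int[Q]_w (\prod_(j < K) `|path_of U w (k + bump 0 j)%N|)%:E =
      (k.+2%:R / (k.+1 + K).+1%:R)%:E)%E.
    rewrite -ih; apply: eq_integral => w _; congr EFin; apply: eq_bigr => j _.
    by rewrite /bump leq0n add1n addSnnS.
  rewrite -EFinM; congr EFin; rewrite addSnnS.
  by rewrite mulrA divfK.
- by apply/seteqP; split => // i [/= ->]; rewrite /D2 /= ltnn.
- exact/measurable_EFinP.
- by move=> e; rewrite lee_fin.
- exact/measurable_EFinP.
- by move=> e; rewrite lee_fin prodr_ge0.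
Qed.

End size_biased_sticks.

Section ranked_sizes.
Context {R : realType}.
Implicit Types (g : {ptws nat -> R} -> R).

Definition ranked_sizes n (c : seq nat) : {ptws nat -> R} :=
  fun k => (nth 0%N (sort geq c) k)%:R / n%:R.

Lemma ranked_sizes_perm n c c' : perm_eq c c' -> ranked_sizes n c = ranked_sizes n c'.
Proof.
move=> cc'; rewrite /ranked_sizes; apply/funext => k.
suff -> : sort geq c = sort geq c' by [].
apply/perm_sortP => //.
- by move=> a b; exact: leq_total.
- by move=> a b e ab ea; exact: (leq_trans ea ab).
- by move=> a b /andP[/= ab ba]; apply/eqP; rewrite eqn_leq ba ab.
Qed.

Lemma ranked_sizes_cube n c : (forall a, a \in c -> (a <= n)%N) -> unit_cube (ranked_sizes n c).
Proof.
move=> cn; apply/unit_cubeP => k; rewrite /ranked_sizes.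
rewrite divr_ge0//=; case: n cn => [|n] cn; first by rewrite invr0 mulr0.
rewrite ler_pdivrMr ?ltr0n// mul1r ler_nat.
have [kc|kc] := ltnP k (size (sort geq c)); last by rewrite nth_default.
by apply: cn; rewrite -(mem_sort geq) mem_nth.
Qed.

Lemma sumn_mem_le c a : a \in c -> (a <= sumn c)%N.
Proof.
elim: c => //= b c ih; rewrite in_cons => /orP[/eqP->|/ih]; first exact: leq_addr.
by move=> h; exact: (leq_trans h (leq_addl _ _)).
Qed.

Lemma ages_le (x : nat -> R) n a : a \in ages x n -> (a <= n)%N.
Proof.
rewrite /ages mem_rcons in_cons => /orP[/eqP->|]; first exact: leq_subr.
move=> /mapP[k]; rewrite mem_iota => /andP[_]; rewrite add0n => kR ->.
have : reached (record_time x k.+1) n.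
  case e : (record_count x n) kR => [|m] //= km.
  by have [/(reached_le km)] := (record_countP x n m).1 e.
rewrite /age; case: (record_time x k.+1) => //= s sn.
exact: (leq_trans (leq_subr _ _) sn).
Qed.

Lemma relative_ranked_ages_cube (x : nat -> R) n : unit_cube (relative_ranked_ages x n).
Proof. by apply: (@ranked_sizes_cube n (ages x n)) => a; exact: ages_le. Qed.

Lemma stick_breaking_unit (u : nat -> R) i : (forall k, 0 <= u k <= 1) ->
  0 <= stick_breaking u i <= 1.
Proof.
move=> u01; have := u01 i; have := prod_unit_ge0 i u01.
have := prod_unit_decr u01 (leq0n i); rewrite big_ord0 /stick_breaking.
by move: (\prod_(_ < _) _) => p; nra.
Qed.

Lemma stick_breaking_cube (u w : nat -> R) : (forall k, 0 <= u k <= 1) ->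
  decreasing_rearrangement (stick_breaking u) w -> unit_cube w.
Proof.
move=> u01 [_ [s _ ws]]; apply/unit_cubeP => k; rewrite ws.
exact: stick_breaking_unit.
Qed.

Lemma picks_mean_stick_breaking g (C e : R) K (u w : nat -> R) n :
  0 <= C -> (0 < n)%N -> (forall k, 0 <= u k <= 1) ->
  decreasing_rearrangement (stick_breaking u) w ->
  (forall x y r, unit_cube x -> unit_cube y -> (forall k, `|x k - y k| <= r) ->
     `|g x - g y| <= e + C * r ^+ 2) ->
  `|picks_mean K u n (g \o ranked_sizes n) - g w| <=
  8 * C * (1 + 2 * pick_bound K) / n%:R + (e + 2 * C * \prod_(j < K.+1) u j).
Proof.
move=> C0 n0 u01 uw gC; set p := \prod_(_ < _) _.
have p0 : 0 <= p by exact: prod_unit_ge0.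
have p1 : p <= 1 by have := prod_unit_decr u01 (leq0n K.+1); rewrite big_ord0.
have n0R : 0 < n%:R :> R by rewrite ltr0n.
set x := 8 * C / n%:R ^+ 2.
have x0 : 0 <= x by rewrite divr_ge0 ?sqr_ge0//; lra.
have -> : 8 * C * (1 + 2 * pick_bound K) / n%:R =
    x * ((1 + 2 * pick_bound K) * n%:R) by rewrite /x; field; rewrite lt0r_neq0.
apply: le_trans (picks_mean_pick_dist K n _ u01 x0).
apply: picks_mean_dist => // c cn.
set D := pick_dist _ _ _ _ _ _.
have D0 : 0 <= D by exact: pick_dist_ge0.
have := sqr_sqrtr D0; have := sqrtr_ge0 D; set s := Num.sqrt D => s0 sD.
have := gC (ranked_sizes n c) w (p + 2 * s / n%:R).
move=> /(_ _ _ _)/le_trans; apply.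
- by apply: ranked_sizes_cube => a; rewrite -cn; exact: sumn_mem_le.
- exact: stick_breaking_cube uw.
- move=> k; apply: (decreasing_rearrangement_dist
    (sort_decreasing_rearrangement c n) uw) => i.
  rewrite -(ler_pM2l n0R) -[X in X * _ <= _](gtr0_norm n0R) -normrM.
  have -> : n%:R * ((nth 0%N c i)%:R / n%:R - stick_breaking u i) =
      (nth 0%N c i)%:R - n%:R * stick_breaking u i by field; rewrite lt0r_neq0.
  have -> : n%:R * (p + 2 * s / n%:R) = n%:R * p + 2 * s by field; rewrite lt0r_neq0.
  exact: picks_stick_breaking.
(* With [t = s / n], [(p + 2 t)^2 <= 2 p^2 + 8 t^2 <= 2 p + 8 t^2] since [p <= 1]; hence the 8 in
   [x]. Replacing [p^2] by [p] leaves only a first moment to compute. *)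
have -> : x * D + (e + 2 * C * p) = e + C * (2 * p + 8 * (s / n%:R) ^+ 2).
  by rewrite /x -sD; field; rewrite lt0r_neq0.
rewrite lerD2l; apply: ler_wpM2l => //.
rewrite -mulrA; move: (s / n%:R) => t.
have := sqr_ge0 (p - 2 * t); nra.
Qed.

End ranked_sizes.

Section integrals.
Context d (T : measurableType d) (R : realType) (Q : probability T R).
Local Notation seqs D := (@g_sigma_algebraType (nat -> R) (cylinder D)).

Lemma beta_law_unit a b (Y : {RV Q >-> R}) : beta_law a b Y ->
  {ae Q, forall w, 0 <= Y w <= 1}.
Proof.
move=> bY; exists (Y @^-1` (~` `[0, 1])); split.
- by apply: measurable_funPTI; exact: measurableC.
- have := bY _ (measurableC (measurable_itv `[0, 1])).
  rewrite /distribution /pushforward => ->.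
  rewrite [X in integral _ X _](_ : _ = set0) ?integral_set0//.
  apply/seteqP; split => // x [/= nx x01]; apply: nx.
  exact: (@subset_itv_oo_cc _ _ _ _ x x01).
- by move=> w /= nw; rewrite in_itv/=.
Qed.

Lemma measurable_picks_mean K n (G : seq nat -> R) :
  measurable_fun setT (fun e : seqs setT => picks_mean K e n G).
Proof.
apply: measurable_sum => j; apply: measurable_funM; last exact: measurable_bernstein_mean.
exact: (measurableT_comp (@measurable_bernstein R n j) (@measurable_coordinate R setT 0%N I)).
Qed.

Lemma ge0_integral_affine (f h : T -> R) (x y : R) :
  measurable_fun setT f -> measurable_fun setT h ->
  (forall w, 0 <= f w) -> (forall w, 0 <= h w) -> 0 <= x -> 0 <= y ->
  (\int[Q]_w (f w + (x + y * h w))%:E =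
   \int[Q]_w (f w)%:E + (x%:E + y%:E * \int[Q]_w (h w)%:E))%E.
Proof.
move=> mf mh f0 h0 x0 y0.
have yh0 w : 0 <= y * h w by rewrite mulr_ge0.
have myh : measurable_fun setT (fun w => y * h w) by exact: measurable_funM.
under eq_integral do rewrite EFinD.
rewrite ge0_integralD//; last 4 first.
- by move=> w _; rewrite lee_fin.
- exact/measurable_EFinP.
- by move=> w _; rewrite lee_fin addr_ge0.
- by apply/measurable_EFinP; exact: measurable_funD.
congr (_ + _)%E.
under eq_integral do rewrite EFinD.
rewrite ge0_integralD//; [|by move=> w _; rewrite lee_fin|exact/measurable_EFinP].
rewrite integral_cst//; rewrite [X in (_ * X)%E]probability_setT mule1; congr (_ + _)%E.
under eq_integral do rewrite EFinM.
by rewrite ge0_integralZl_EFin//; [move=> w _; rewrite lee_fin|exact/measurable_EFinP].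
Qed.

End integrals.

(** * Passage to the limit *)

Section stick_limit.
Context d (T : measurableType d) (R : realType) (Q : probability T R).
Variables (U : nat -> {RV Q >-> R}) (W : {RV Q >-> sequence_space R}).
Hypothesis Uindep : mutually_independent U.
Hypothesis Ubeta : forall i, beta_law (0 + i.+1%:R * (1 / 2)) (1 - 1 / 2) (U i).
Hypothesis UW : {ae Q, forall w,
  decreasing_rearrangement (stick_breaking (fun i => U i w)) (W w)}.
Variables (g : {ptws nat -> R} -> R) (b : R).
Hypothesis mg : measurable_fun setT (g : sequence_space R -> R).
Hypothesis g0 : forall x, 0 <= g x.
Hypothesis gb : (\int[Q]_w (g (W w))%:E = b%:E)%E.

Lemma renewal_mean_stick_breaking (C e : R) K n : 0 <= C -> 0 <= e -> (0 < n)%N ->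
  (forall x y r, unit_cube x -> unit_cube y -> (forall k, `|x k - y k| <= r) ->
     `|g x - g y| <= e + C * r ^+ 2) ->
  `|renewal_mean n (g \o ranked_sizes n) - b| <=
  8 * C * (1 + 2 * pick_bound K) / n%:R + e + 2 * C / K.+2%:R.
Proof.
move=> C0 e0 n0 gC; set G := g \o _.
have GP : perm_inv G by move=> c c' cc'; rewrite /G /= (ranked_sizes_perm _ cc').
pose F w := picks_mean K (path_of U w) n G.
pose h w := \prod_(j < K.+1) `|U (0 + j)%N w|.
set x0 := 8 * C * _ / _.
have x0_ge0 : 0 <= x0 + e.
  rewrite addr_ge0// divr_ge0// mulr_ge0 ?mulr_ge0// addr_ge0// mulr_ge0//.
  exact: le_trans (pick_bound_ge K).
have F0 w : 0 <= F w.
  apply: sumr_ge0 => j _; rewrite mulr_ge0 ?bernstein_ge0//.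
  by apply: bernstein_mean_ge0 => c _; exact: g0.
have mF : measurable_fun setT F.
  exact: (measurableT_comp (@measurable_picks_mean R K n G) (@measurable_path_of _ _ _ _ U setT)).
have mgW : measurable_fun setT (g \o W) by exact: measurableT_comp.
have h0 w : 0 <= h w by apply: prodr_ge0.
have mh : measurable_fun setT h.
  by apply: measurable_prod => j _; exact: measurableT_comp.
have intF : (\int[Q]_w (F w)%:E = (renewal_mean n G)%:E)%E.
  by apply: (picks_mean_expectation Uindep Ubeta K n) GP => c; exact: g0.
have inth : (\int[Q]_w (h w)%:E = (1 / K.+2%:R)%:E)%E.
  by rewrite (stick_remainder_expectation Uindep Ubeta K.+1 0) add0n.
have good : {ae Q, forall w, `|F w - g (W w)| <= x0 + e + 2 * C * h w}.
  have U01 : {ae Q, forall w i, 0 <= U i w <= 1}.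
    by apply: ae_foralln => i; apply: (beta_law_unit (Ubeta i)).
  apply: filterS2 U01 UW => w u01 uw.
  have := picks_mean_stick_breaking K C0 n0 u01 uw gC.
  suff -> : h w = \prod_(j < K.+1) U j w by rewrite addrA.
  by apply: eq_bigr => j _; rewrite add0n ger0_norm//; case/andP: (u01 j).
(* The two-sided estimate is split into two inequalities between integrals of nonnegative functions,
   which avoids integrating a difference. *)
have mono (f1 f2 : T -> R) : measurable_fun setT f1 -> measurable_fun setT f2 ->
    (forall w, 0 <= f1 w) -> (forall w, 0 <= f2 w) ->
    {ae Q, forall w, `|f1 w - f2 w| <= x0 + e + 2 * C * h w} ->
    (\int[Q]_w (f1 w)%:E <= \int[Q]_w (f2 w)%:E + (x0 + e + 2 * C / K.+2%:R)%:E)%E.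
  move=> mf1 mf2 f10 f20 f12.
  have -> : (x0 + e + 2 * C / K.+2%:R)%:E = ((x0 + e)%:E + (2 * C)%:E * \int[Q]_w (h w)%:E)%E.
    by rewrite inth -EFinM -EFinD mul1r.
  have C20 : 0 <= 2 * C by rewrite mulr_ge0.
  rewrite -ge0_integral_affine//.
  apply: ae_ge0_le_integral => //.
  - by move=> w _; rewrite lee_fin.
  - exact/measurable_EFinP.
  - by move=> w _; rewrite lee_fin addr_ge0 ?f20 ?(addr_ge0 x0_ge0) ?mulr_ge0.
  - apply/measurable_EFinP; apply: measurable_funD => //.
    by apply: measurable_funD => //; exact: measurable_funM.
  - apply: filterS f12 => w + _; rewrite lee_fin ler_norml => /andP[_].
    by rewrite lerBlDl.
have le1 := mono F (g \o W) mF mgW F0 (fun w => g0 _) good.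
have le2 : (\int[Q]_w (g (W w))%:E <= \int[Q]_w (F w)%:E + (x0 + e + 2 * C / K.+2%:R)%:E)%E.
  apply: (mono (g \o W) F mgW mF (fun w => g0 _) F0).
  by apply: filterS good => w; rewrite distrC.
move: le1 le2; rewrite /= intF gb -!EFinD !lee_fin ler_norml => le1 le2.
move: (x0 + e + _) (renewal_mean _ _) le1 le2 => S A le1 le2.
by apply/andP; split; lra.
Qed.

Lemma renewal_mean_cvg (B : R) : (forall x, g x <= B) ->
  (forall e, 0 < e -> exists2 r : R, 0 < r & forall x y, unit_cube x -> unit_cube y ->
     (forall k, `|x k - y k| <= r) -> `|g x - g y| <= e) ->
  renewal_mean n (g \o ranked_sizes n) @[n --> \oo] --> b.
Proof.
move=> gB gu; apply/cvgrPdist_le => e e0.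
have e3 : 0 < e / 3 by rewrite divr_gt0.
have [r r0 rg] := gu _ e3.
have B0 : 0 <= B := le_trans (g0 point) (gB point).
(* Values of [g] differ by at most [B], and [B <= C * t ^+ 2] as soon as [t > r]. *)
pose C := B / r ^+ 2.
have C0 : 0 <= C by rewrite divr_ge0 ?sqr_ge0.
(* A quadratic modulus, since the distance to the sticks is controlled in mean
   square. *)
have modulus x y t : unit_cube x -> unit_cube y -> (forall k, `|x k - y k| <= t) ->
    `|g x - g y| <= e / 3 + C * t ^+ 2.
  move=> cx cy xyt; have [tr|rt] := leP t r.
    apply: (@le_trans _ _ (e / 3)).
      by apply: rg => // k; exact: le_trans (xyt k) tr.
    by rewrite lerDl mulr_ge0 ?sqr_ge0.
  apply: (@le_trans _ _ B).
    by rewrite ler_norml; have := g0 x; have := g0 y; have := gB x; have := gB y; lra.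
  apply: (@le_trans _ _ (C * t ^+ 2)); last by rewrite lerDr ltW.
  rewrite /C mulrAC ler_pdivlMr ?exprn_gt0//; apply: ler_wpM2l => //.
  by rewrite ler_sqr ?nnegrE; [exact: ltW|exact: ltW|exact: ltW (lt_trans r0 rt)].
(* [C] is already fixed, so [K] can be chosen before [n], whose threshold involves
   [pick_bound K]. *)
pose K := Num.truncn (2 * C / (e / 3)).
have KC : 2 * C / K.+2%:R <= e / 3.
  rewrite ler_pdivrMr ?ltr0n// [leRHS]mulrC -ler_pdivrMr//.
  apply: (le_trans (ltW (truncnS_gt _))); rewrite ler_nat; exact: leqnSn.
pose A := 8 * C * (1 + 2 * pick_bound K).
exists (Num.truncn (A / (e / 3))).+1 => // n /= nA.
have n0 : (0 < n)%N by exact: leq_ltn_trans nA.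
have nAe : A / n%:R <= e / 3.
  rewrite ler_pdivrMr ?ltr0n// [leRHS]mulrC -ler_pdivrMr//.
  by apply: (le_trans (ltW (truncnS_gt _))); rewrite ler_nat.
rewrite distrC; apply: le_trans (renewal_mean_stick_breaking K C0 (ltW e3) n0 modulus) _.
by rewrite -/A; move: (A / n%:R) (2 * C / _) nAe KC => s t; lra.
Qed.

End stick_limit.

(** Reduces bounded functions to nonnegative ones; since the mass of [D] is 1, the correction is
    exactly [M]. *)
Lemma integral_shift d (T : measurableType d) (R : realType) (Q : probability T R)
    (D : set T) (h : T -> R) (M : R) : measurable D -> Q D = 1%E ->
  measurable_fun D h -> (forall x, D x -> `|h x| <= M) ->
  (\int[Q]_(x in D) (h x)%:E = \int[Q]_(x in D) (h x + M)%:E - M%:E)%E.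
Proof.
move=> mD QD mh hM.
have ih : Q.-integrable D (EFin \o h).
  apply: measurable_bounded_integrable => //; first by rewrite [ltLHS]QD ltry.
  exists M; split; first exact: num_real.
  by move=> x Mx y Dy; exact: le_trans (hM y Dy) (ltW Mx).
have iM : Q.-integrable D (EFin \o (fun=> M)).
  apply: measurable_bounded_integrable => //; first by rewrite [ltLHS]QD ltry.
  exists `|M|; split; first exact: num_real.
  by move=> x Mx y Dy; exact: ltW Mx.
have -> : (\int[Q]_(x in D) (h x + M)%:E = \int[Q]_(x in D) (h x)%:E + M%:E)%E.
  by rewrite (integralD_EFin mD ih iM) integral_cst// [X in (_ * X)%E]QD mule1.
by rewrite addeK.
Qed.

Theorem theorem4 (R : realType) (d : measure_display) (T : measurableType d)
    (P : probability T R) (eta : nat -> {RV P >-> R})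
    (eta_indep : mutually_independent eta)
    (eta_id : identically_distributed eta)
    (eta_sym : forall i, symmetric_law (eta i))
    (eta_cont : forall i, continuous_law (eta i))
    (PD : probability (sequence_space R) R) (hPD : is_PD (1 / 2) 0 PD) :
  cvg_in_law P (fun n w => relative_ranked_ages (walk (fun i => eta i w)) n) PD.
Proof.
case: hPD => _ _ [dQ [TQ [Q [U [W [Uindep Ubeta UW PDE]]]]]] f cf.
have [M M0 fM] := unit_cube_continuous_bounded cf.
(* [f] is only controlled on the cube. Adding [M] there and setting the value 0 elsewhere gives a
   nonnegative, bounded function measurable on the whole sequence space. *)
pose g (x : {ptws nat -> R}) : R := ((fun x => f x + M) \_ (@unit_cube R)) x.
have gE x : unit_cube x -> g x = f x + M by move=> cx; rewrite /g patchE mem_set.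
have gN x : ~ unit_cube x -> g x = 0 by move=> cx; rewrite /g patchE memNset.
have g0 x : 0 <= g x.
  have [cx|cx] := pselect (unit_cube x); last by rewrite gN.
  by rewrite gE//; have := fM _ cx; rewrite ler_norml; lra.
have gM x : g x <= 2 * M.
  have [cx|cx] := pselect (unit_cube x); last by rewrite gN// mulr_ge0.
  by rewrite gE//; have := fM _ cx; rewrite ler_norml; lra.
have mf := measurable_unit_cube_continuous cf.
have mfM : measurable_fun (@unit_cube R : set (sequence_space R))
    ((fun x => f x + M) : sequence_space R -> R) by exact: measurable_funD.
have mg : measurable_fun setT (g : sequence_space R -> R).
  exact: (measurable_restrictT _ (@measurable_unit_cube R)).1 mfM.
have mgW : measurable_fun setT (g \o W) by exact: measurableT_comp.
(* Adding [M] changes the limit integral by exactly [M] only if the cube has full mass, which holds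
   because the sticks lie almost surely in [0, 1]. *)
have PDcube : PD (@unit_cube R) = 1%E.
  have mW : measurable (W @^-1` (@unit_cube R)).
    by rewrite -[X in measurable X]setTI; apply: measurable_funP => //; exact: measurable_unit_cube.
  rewrite PDE; last exact: measurable_unit_cube.
  rewrite /distribution /pushforward.
  have W0 : Q (~` (W @^-1` (@unit_cube R))) = 0%E.
    apply: measure_negligible; first exact: measurableC.
    have U01 : {ae Q, forall w i, 0 <= U i w <= 1}.
      by apply: ae_foralln => i; exact: beta_law_unit (Ubeta i).
    by apply: filterS2 U01 UW => w u01; exact: stick_breaking_cube.
  by rewrite -[X in Q X]setCK probability_setC ?W0 ?sube0//; exact: measurableC.
pose b := fine (\int[Q]_w (g (W w))%:E)%E.
have gb : (\int[Q]_w (g (W w))%:E = b%:E)%E.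
  rewrite fineK// ge0_fin_numE; last by apply: integral_ge0 => w _; rewrite lee_fin.
  apply: (@le_lt_trans _ _ (\int[Q]_w (2 * M)%:E)%E).
    apply: ge0_le_integral => //.
    - by move=> w _; rewrite lee_fin.
    - exact/measurable_EFinP.
    - by move=> w _; rewrite lee_fin.
  by rewrite integral_cst// [X in (_ * X)%E]probability_setT mule1 ltry.
have -> : (\int[PD]_(x in @unit_cube R) (f x)%:E = (b - M)%:E)%E.
  rewrite (integral_shift (@measurable_unit_cube R) PDcube mf fM).
  rewrite integral_mkcond EFinB -gb; congr (_ - _)%E.
  transitivity (\int[distribution Q W]_x (g x)%:E)%E.
    rewrite (eq_measure_integral (distribution Q W)); last by move=> A mA _; exact: PDE.
    apply: eq_integral => x _; have [cx|cx] := pselect (unit_cube x).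
      by rewrite patchE mem_set// gE.
    by rewrite patchE memNset// gN.
  by rewrite ge0_integral_distribution//; exact/measurable_EFinP.
(* For each [n] the expectation over the walk is replaced by an equal renewal sum; from here on the
   law of the jumps no longer appears. *)
have -> : (fun n => 'E_P[fun w => f (relative_ranked_ages (walk (fun i => eta i w)) n)])%E =
    (fun n => (renewal_mean n (g \o ranked_sizes n) - M)%:E).
  apply/funext => n; rewrite unlock.
  have mfn : measurable_fun setT (fun w => f (relative_ranked_ages (walk (path_of eta w)) n)).
    have := @measurable_path_of _ _ _ _ eta setT.
    by apply: (measurableT_comp (@measurable_ages R (f \o ranked_sizes n) n)).
  rewrite (@integral_shift _ _ _ _ _ _ M measurableT (@probability_setT _ _ _ P) mfn); last first.
    by move=> w _; apply: fM; exact: relative_ranked_ages_cube.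
  rewrite EFinB; congr (_ - _)%E.
  rewrite -(ages_mean eta_indep eta_id eta_sym eta_cont)//; last by move=> c; exact: g0.
  apply: eq_integral => w _; rewrite /= gE//; exact: relative_ranked_ages_cube.
apply: cvg_EFin; first by near=> n.
apply: cvgB; last exact: cvg_cst.
apply: (renewal_mean_cvg Uindep Ubeta UW mg g0 gb gM) => e e0.
have [r r0 rf] := unit_cube_unif_continuous cf e0.
exists r => // x y cx cy xy; rewrite (gE x cx) (gE y cy) opprD addrACA subrr addr0; exact: rf.
Unshelve. all: by end_near. Qed.
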